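(* Let $S_1,S_2$ be two isometries with $S_1S_1^*+S_2S_2^*=1$, so that $C^*(S_1,S_2)=\mathcal{O}_2$. Let $\sigma$ be the automorphism of $\mathcal{O}_2$ defined by $\sigma(S_1)=S_2$ and $\sigma(S_2)=S_1$. Then $\mathcal{O}_2\rtimes_\sigma\mathbb{Z}$ is *-isomorphic to $$\left\{f\in C\left([-1,1],\mathcal{O}_2\rtimes_\sigma\mathbb{Z}_2\right):f(-1)=\widehat{\sigma}(f(1))\right\}.$$
   Context: The Cuntz algebra $\mathcal{O}_2$ is the universal unital (simple) C*-algebra generated by two isometries $S_1,S_2$ with $S_1S_1^*+S_2S_2^*=1$; for any two isometries satisfying this relation on a nonzero Hilbert space, $C^*(S_1,S_2)$ is (canonically) $\mathcal{O}_2$. The automorphism $\sigma$ satisfies $\sigma^2=\mathrm{id}$. The crossed-product $\mathcal{O}_2\rtimes_\sigma\mathbb{Z}$ is the universal C*-algebra generated by a copy of $\mathcal{O}_2$ and a unitary $V$ such that $VaV^*=\sigma(a)$ for all $a\in\mathcal{O}_2$. The crossed-product $\mathcal{O}_2\rtimes_\sigma\mathbb{Z}_2$ is the universal C*-algebra generated by two isometries $S_1,S_2$ with $S_1S_1^*+S_2S_2^*=1$ (generating a copy of $\mathcal{O}_2$) and a unitary $w$ with $w^2=1$ and $wS_1=S_2w$. The automorphism $\widehat{\sigma}$ of $\mathcal{O}_2\rtimes_\sigma\mathbb{Z}_2$ is the one uniquely determined by $\widehat{\sigma}(a)=a$ for $a\in\mathcal{O}_2$ and $\widehat{\sigma}(w)=-w$.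 $C(X,B)$ denotes the C*-algebra of continuous functions from a compact space $X$ to a C*-algebra $B$, with pointwise operations and supremum norm. *)

(* Defs.v *)
From HB Require Import structures.
From mathcomp Require Import all_boot all_order all_algebra.
From mathcomp Require Import all_classical all_reals all_analysis.
From mathcomp Require Import complex ring lra.
Set Implicit Arguments.
Unset Strict Implicit.
Unset Printing Implicit Defensive.
Import Order.TTheory GRing.Theory Num.Theory numFieldNormedType.Exports.
Local Open Scope classical_set_scope.
Local Open Scope complex_scope.
Local Open Scope ring_scope.

(* All C*-algebras are unital and nonzero (1 != 0 is part of GRing.Algebra).
   The norm is real-valued.  It is not a Num.NormedZmodule norm in this
   structure, because that class is already joined with rings in
   Num.NumDomain; the R[i]-normed module structure is derived below. *)
HB.mixin Record isCStar (R : realType) A & GRing.Algebra R[i] A := {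
  star : A -> A ;
  cnorm : A -> R ;
  starD : forall x y, star (x + y) = star x + star y ;
  starZ : forall (c : R[i]) x, star (c *: x) = c^* *: star x ;
  starM : forall x y, star (x * y) = star y * star x ;
  starK : forall x, star (star x) = x ;
  cnormD : forall x y, cnorm (x + y) <= cnorm x + cnorm y ;
  cnormZ : forall (c : R[i]) x, (cnorm (c *: x))%:C = `|c| * (cnorm x)%:C ;
  cnorm0_eq0 : forall x, cnorm x = 0 -> x = 0 ;
  cnormM : forall x y, cnorm (x * y) <= cnorm x * cnorm y ;
  cnorm_starM : forall x, cnorm (star x * x) = cnorm x ^+ 2 ;
  cnorm_complete : forall u : nat -> A,
    (forall e : R, 0 < e -> exists N, forall m n,
      (N <= m)%N -> (N <= n)%N -> cnorm (u m - u n) < e) ->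
    exists l : A, forall e : R, 0 < e -> exists N, forall n,
      (N <= n)%N -> cnorm (u n - l) < e
}.

#[short(type="cstarAlgType")]
HB.structure Definition CStarAlg (R : realType) :=
  {A of GRing.Algebra R[i] A & isCStar R A}.

HB.mixin Record isStarMorphism (R : realType) (A B : cstarAlgType R)
    (f : A -> B) := {
  star_morph : forall x, f (star x) = star (f x)
}.

HB.structure Definition StarMorphism (R : realType) (A B : cstarAlgType R) :=
  {f of @GRing.LRMorphism R[i] A B *:%R f & isStarMorphism R A B f}.

(* unital *-homomorphisms *)
Notation "{ 'starhom' A -> B }" := (@StarMorphism.type _ A B)
  (at level 0, A at level 98, B at level 99,
   format "{ 'starhom'  A  ->  B }") : type_scope.

Section norm_topology.
Variables (R : realType) (A : cstarAlgType R).

Let nrm (x : A) : R[i] := (cnorm x)%:C.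

Let nrmD x y : nrm (x + y) <= nrm x + nrm y.
Proof. by rewrite /nrm -rmorphD lecR cnormD. Qed.

Let nrmZ (c : R[i]) x : nrm (c *: x) = `|c| * nrm x.
Proof. exact: cnormZ. Qed.

Let nrm0_eq0 x : nrm x = 0 -> x = 0.
Proof. by move=> /(congr1 (@complex.Re R)) /cnorm0_eq0. Qed.

HB.instance Definition _ :=
  @Lmodule_isNormed.Build R[i] (CStarAlg.sort A) nrm nrmD nrmZ nrm0_eq0.

Lemma cnormE (x : A) : `|x| = (cnorm x)%:C. Proof. by []. Qed.

Lemma cnorm0 : cnorm (0 : A) = 0.
Proof. by apply: complexI; rewrite -cnormE normr0. Qed.

Lemma cnorm_ge0 (x : A) : 0 <= cnorm x.
Proof. by rewrite -lecR -cnormE normr_ge0. Qed.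

Lemma cnormN (x : A) : cnorm (- x) = cnorm x.
Proof. by apply: complexI; rewrite -!cnormE normrN. Qed.

Lemma cnormB (x y : A) : cnorm (x - y) = cnorm (y - x).
Proof. by rewrite -cnormN opprB. Qed.

Lemma cnorm_tri (x y z : A) : cnorm (x - z) <= cnorm (x - y) + cnorm (y - z).
Proof. by rewrite -[x - z](subrKA y) cnormD. Qed.

Lemma cnorm_dist (x y : A) : `|cnorm x - cnorm y| <= cnorm (x - y).
Proof.
have H (a b : A) : cnorm a - cnorm b <= cnorm (a - b).
  by rewrite lerBlDr -{1}[a](subrK b) cnormD.
by rewrite ler_norml H andbT lerNl opprB cnormB.
Qed.

Lemma star1 : star (1 : A) = 1.
Proof. by rewrite -[LHS]mul1r -{1}(starK 1) -starM mul1r starK. Qed.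

Lemma starN (x : A) : star (- x) = - star x.
Proof.
rewrite -scaleN1r starZ -[RHS]scaleN1r; congr (_ *: _).
by rewrite rmorphN rmorph1.
Qed.

Lemma cnorm_star (x : A) : cnorm (star x) = cnorm x.
Proof.
have H (a : A) : cnorm a <= cnorm (star a).
  have [a0|a0] := leP (cnorm a) 0; first exact: le_trans a0 (cnorm_ge0 _).
  by rewrite -(ler_pM2r a0) -expr2 -cnorm_starM cnormM.
by apply/eqP; rewrite eq_le H andbT -{2}(starK x) H.
Qed.

Lemma cvg_cnormP {T : Type} {F : set_system T} {FF : Filter F}
    (f : T -> A) (l : A) :
  f @ F --> l <->
  forall e : R, 0 < e -> \forall x \near F, cnorm (l - f x) < e.
Proof.
split=> [/cvgrPdist_lt H e e0|H].
  have e0' : 0 < e%:C by rewrite ltcR.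
  by apply: filterS (H _ e0') => x; rewrite cnormE ltcR.
apply/cvgrPdist_lt => e e0.
have er : e = (complex.Re e)%:C by rewrite RRe_real // gtr0_real.
move: e0; rewrite er ltcR => /H.
by apply: filterS => x; rewrite cnormE ltcR.
Qed.

End norm_topology.

Definition segment (R : realType) : set R := `[-1, 1].
Arguments segment : clear implicits.

(* Coerced to a type, [segment R] carries the subspace topology. *)
Definition CI (R : realType) (B : cstarAlgType R) :=
  continuousType (segment R) B.

Section segment_points.
Variable R : realType.

Lemma segment_leftP : (-1 : R) \in segment R.
Proof. by rewrite inE /segment /= in_itv /=; apply/andP; split; lra. Qed.

Lemma segment_rightP : (1 : R) \in segment R.
Proof. by rewrite inE /segment /= in_itv /=; apply/andP; split; lra. Qed.

Definition segm1 : segment R := exist _ (-1) segment_leftP.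
Definition seg1 : segment R := exist _ 1 segment_rightP.

End segment_points.
Arguments segm1 {R}.
Arguments seg1 {R}.

Section continuous_functions.
Variables (R : realType) (B : cstarAlgType R).
Implicit Types f g h : CI B.

HB.instance Definition _ := Choice.on (CI B).

Lemma CI_ext f g : f =1 g -> f = g.
Proof. by move/continuousEP. Qed.

Lemma CI_cts f : continuous f. Proof. exact: cts_fun. Qed.

Definition CI_mk (f : segment R -> B) (cf : continuous f) : CI B :=
  mkcts cf : continuousType _ _.

Lemma CI_mkE (f : segment R -> B) (cf : continuous f) x : CI_mk cf x = f x.
Proof. by []. Qed.

Lemma add_cts f g : continuous (fun x => f x + g x).
Proof. by move=> x; exact: (cvgD (@CI_cts f x) (@CI_cts g x)). Qed.

Lemma opp_cts f : continuous (fun x => - f x).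
Proof. by move=> x; exact: (cvgN (@CI_cts f x)). Qed.

Lemma scale_cts (c : R[i]) f : continuous (fun x => c *: f x).
Proof. by move=> x; exact: (cvgZl_tmp (@CI_cts f x)). Qed.

Lemma star_cts f : continuous (fun x => star (f x)).
Proof.
move=> x; have FF : Filter (nbhs x) := nbhs_filter x.
apply/cvg_cnormP => e e0.
have /cvg_cnormP/(_ e e0) := @CI_cts f x.
by apply: filterS => y; rewrite -starN -starD cnorm_star.
Qed.

Lemma mul_cts f g : continuous (fun x => f x * g x).
Proof.
move=> x; have FF : Filter (nbhs x) := nbhs_filter x.
apply/cvg_cnormP => e e0.
pose M := cnorm (f x) + cnorm (g x) + 1.
have M0 : 0 < M by rewrite ltr_wpDl ?ltr01 ?addr_ge0 ?cnorm_ge0.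
pose d := Num.min 1 (e / (M + M)).
have MM0 : 0 < M + M by exact: addr_gt0.
have d0 : 0 < d.
  by rewrite /d lt_min; apply/andP; split; [exact: ltr01|exact: divr_gt0].
have /cvg_cnormP/(_ d d0) fx := @CI_cts f x.
have /cvg_cnormP/(_ d d0) gx := @CI_cts g x.
near=> y.
have fy : cnorm (f x - f y) < d by near: y.
have gy : cnorm (g x - g y) < d by near: y.
have gM : cnorm (g y) <= M.
  rewrite -[g y](subrK (g x)) (le_trans (cnormD _ _)) // cnormB.
  have gy1 : cnorm (g x - g y) <= 1 by rewrite (le_trans (ltW gy)) // ge_min lexx.
  have := cnorm_ge0 (f x); rewrite /M; lra.
have fM : cnorm (f x) <= M.
  by have := cnorm_ge0 (g x); rewrite /M; lra.
have -> : f x * g x - f y * g y = f x * (g x - g y) + (f x - f y) * g y.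
  by rewrite mulrBr mulrBl addrA subrK.
apply: (le_lt_trans (cnormD _ _)).
apply: (@le_lt_trans _ _ (M * cnorm (g x - g y) + M * cnorm (f x - f y))).
  apply: lerD; apply: (le_trans (cnormM _ _)).
    by rewrite ler_wpM2r ?cnorm_ge0.
  by rewrite mulrC ler_wpM2r ?cnorm_ge0.
have de : d <= e / (M + M) by rewrite ge_min lexx orbT.
have -> : e = M * (e / (M + M)) + M * (e / (M + M)).
  by rewrite -mulrDl mulrC divfK // gt_eqF.
by apply: ltrD; rewrite ltr_pM2l //; apply: lt_le_trans de.
Unshelve. all: by end_near. Qed.

Definition CI0 : CI B := CI_mk (@cst_continuous (segment R) B 0).
Definition CI1 : CI B := CI_mk (@cst_continuous (segment R) B 1).
Definition CI_add f g : CI B := CI_mk (@add_cts f g).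
Definition CI_opp f : CI B := CI_mk (@opp_cts f).
Definition CI_mul f g : CI B := CI_mk (@mul_cts f g).
Definition CI_scale (c : R[i]) f : CI B := CI_mk (@scale_cts c f).
Definition CI_star f : CI B := CI_mk (@star_cts f).

Definition CI_norm f : R := sup [set cnorm (f x) | x in [set: segment R]].

Lemma CI_addA : associative CI_add.
Proof. by move=> f g h; apply: CI_ext => x; apply: addrA. Qed.
Lemma CI_addC : commutative CI_add.
Proof. by move=> f g; apply: CI_ext => x; apply: addrC. Qed.
Lemma CI_add0 : left_id CI0 CI_add.
Proof. by move=> f; apply: CI_ext => x; apply: add0r. Qed.
Lemma CI_addN : left_inverse CI0 CI_opp CI_add.
Proof. by move=> f; apply: CI_ext => x; apply: addNr. Qed.

HB.instance Definition _ :=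
  GRing.isZmodule.Build (CI B) CI_addA CI_addC CI_add0 CI_addN.

Lemma CI_mulA : associative CI_mul.
Proof. by move=> f g h; apply: CI_ext => x; apply: mulrA. Qed.
Lemma CI_mul1 : left_id CI1 CI_mul.
Proof. by move=> f; apply: CI_ext => x; apply: mul1r. Qed.
Lemma CI_mulr1 : right_id CI1 CI_mul.
Proof. by move=> f; apply: CI_ext => x; apply: mulr1. Qed.
Lemma CI_mulDl : left_distributive CI_mul CI_add.
Proof. by move=> f g h; apply: CI_ext => x; apply: mulrDl. Qed.
Lemma CI_mulDr : right_distributive CI_mul CI_add.
Proof. by move=> f g h; apply: CI_ext => x; apply: mulrDr. Qed.
Lemma CI1_neq0 : CI1 != 0.
Proof.
apply/eqP => /(congr1 (fun f : CI B => f seg1)) /= /eqP.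
by rewrite !CI_mkE /= oner_eq0.
Qed.

HB.instance Definition _ := GRing.Zmodule_isNzRing.Build (CI B)
  CI_mulA CI_mul1 CI_mulr1 CI_mulDl CI_mulDr CI1_neq0.

Lemma CI_scaleA a b f : CI_scale a (CI_scale b f) = CI_scale (a * b) f.
Proof. by apply: CI_ext => x; apply: scalerA. Qed.
Lemma CI_scale1 : left_id 1 CI_scale.
Proof. by move=> f; apply: CI_ext => x; apply: scale1r. Qed.
Lemma CI_scaleDr : right_distributive CI_scale +%R.
Proof. by move=> a f g; apply: CI_ext => x; apply: scalerDr. Qed.
Lemma CI_scaleDl f : {morph CI_scale^~ f : a b / a + b}.
Proof. by move=> a b; apply: CI_ext => x; apply: scalerDl. Qed.

HB.instance Definition _ := GRing.Zmodule_isLmodule.Build R[i] (CI B)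
  CI_scaleA CI_scale1 CI_scaleDr CI_scaleDl.

Lemma CI_scaleAl (a : R[i]) f g : a *: (f * g) = (a *: f) * g.
Proof. by apply: CI_ext => x; apply: scalerAl. Qed.

HB.instance Definition _ :=
  GRing.Lmodule_isLalgebra.Build R[i] (CI B) CI_scaleAl.

Lemma CI_scaleAr (a : R[i]) f g : a *: (f * g) = f * (a *: g).
Proof. by apply: CI_ext => x; apply: scalerAr. Qed.

HB.instance Definition _ :=
  GRing.Lalgebra_isAlgebra.Build R[i] (CI B) CI_scaleAr.

Lemma cnorm_cts f : continuous (fun x => cnorm (f x)).
Proof.
move=> x; have FF : Filter (nbhs x) := nbhs_filter x.
apply/cvgrPdist_lt => e e0.
have /cvg_cnormP/(_ e e0) := @CI_cts f x.
by apply: filterS => y; apply/le_lt_trans/cnorm_dist.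
Qed.

Lemma CI_norm_has_sup f :
  has_sup [set cnorm (f x) | x in [set: segment R]].
Proof.
split; first by exists (cnorm (f seg1)), seg1.
pose h (x : segment R) := cnorm (f x).
have /subspace_valL_continuousP/EVT_max H := @cnorm_cts f.
have m11 : (-1 : R) <= 1 by lra.
have {H m11} [c _ Hc] := H m11; exists (valL h c) => _ [x _ <-].
have <- : valL h (set_val x) = cnorm (f x) := congr1 (@^~ x) (valLK point h).
by apply: Hc; have := set_valP x.
Qed.

Lemma CI_norm_ge f x : cnorm (f x) <= CI_norm f.
Proof. by apply: ub_le_sup; [case: (CI_norm_has_sup f)|exists x]. Qed.

Lemma CI_norm_le f (M : R) : (forall x, cnorm (f x) <= M) -> CI_norm f <= M.
Proof.
move=> H; apply: ge_sup; first by exists (cnorm (f seg1)), seg1.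
by move=> _ [x _ <-].
Qed.

Lemma CI_norm_ge0 f : 0 <= CI_norm f.
Proof. exact: le_trans (cnorm_ge0 _) (CI_norm_ge f seg1). Qed.

Lemma CI_starD f g : CI_star (f + g) = CI_star f + CI_star g.
Proof. by apply: CI_ext => x; apply: starD. Qed.
Lemma CI_starZ (c : R[i]) f : CI_star (c *: f) = c^* *: CI_star f.
Proof. by apply: CI_ext => x; apply: starZ. Qed.
Lemma CI_starM f g : CI_star (f * g) = CI_star g * CI_star f.
Proof. by apply: CI_ext => x; apply: starM. Qed.
Lemma CI_starK f : CI_star (CI_star f) = f.
Proof. by apply: CI_ext => x; apply: starK. Qed.

Lemma CI_normD f g : CI_norm (f + g) <= CI_norm f + CI_norm g.
Proof.
apply: CI_norm_le => x; apply: (le_trans (cnormD _ _)).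
by apply: lerD; apply: CI_norm_ge.
Qed.

Lemma cnormZr (c : R[i]) (x : B) : cnorm (c *: x) = complex.Re `|c| * cnorm x.
Proof.
by apply: complexI; rewrite cnormZ rmorphM; congr (_ * _).
Qed.

Lemma CI_normZ (c : R[i]) f : (CI_norm (c *: f))%:C = `|c| * (CI_norm f)%:C.
Proof.
pose r := complex.Re `|c|.
have nc : `|c| = r%:C by rewrite RRe_real ?normr_real.
rewrite nc -rmorphM; congr (_%:C).
have r0 : 0 <= r by rewrite -lecR -nc normr_ge0.
apply/eqP; rewrite eq_le; apply/andP; split.
  apply: CI_norm_le => x; rewrite cnormZr -/r.
  by rewrite ler_wpM2l // CI_norm_ge.
have [->|rn0] := eqVneq r 0; first by rewrite mul0r CI_norm_ge0.
have rp : 0 < r by rewrite lt_neqAle eq_sym rn0.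
rewrite mulrC -ler_pdivlMr //; apply: CI_norm_le => x.
rewrite ler_pdivlMr // mulrC -[r]/(complex.Re `|c|) -cnormZr.
exact: CI_norm_ge (c *: f) x.
Qed.

Lemma CI_norm0_eq0 f : CI_norm f = 0 -> f = 0.
Proof.
move=> f0; apply: CI_ext => x; apply: cnorm0_eq0; apply/eqP.
by rewrite eq_le cnorm_ge0 andbT -f0 CI_norm_ge.
Qed.

Lemma CI_normM f g : CI_norm (f * g) <= CI_norm f * CI_norm g.
Proof.
apply: CI_norm_le => x; apply: (le_trans (cnormM _ _)).
by apply: ler_pM; rewrite ?cnorm_ge0 ?CI_norm_ge.
Qed.

Lemma CI_norm_starM f : CI_norm (CI_star f * f) = CI_norm f ^+ 2.
Proof.
apply/eqP; rewrite eq_le; apply/andP; split.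
  apply: CI_norm_le => x; rewrite -[leLHS]/(cnorm (star (f x) * f x)) cnorm_starM.
  by rewrite lerXn2r ?nnegrE ?cnorm_ge0 ?CI_norm_ge0 ?CI_norm_ge.
rewrite -[leRHS]sqr_sqrtr ?CI_norm_ge0 //.
rewrite lerXn2r ?nnegrE ?CI_norm_ge0 ?sqrtr_ge0 //.
apply: CI_norm_le => x.
rewrite -[leLHS]ger0_norm ?cnorm_ge0 // -sqrtr_sqr ler_wsqrtr //.
by rewrite -cnorm_starM; exact: CI_norm_ge (CI_star f * f) x.
Qed.

Lemma CI_complete (u : nat -> CI B) :
  (forall e : R, 0 < e -> exists N, forall m n,
    (N <= m)%N -> (N <= n)%N -> CI_norm (u m - u n) < e) ->
  exists l : CI B, forall e : R, 0 < e -> exists N, forall n,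
    (N <= n)%N -> CI_norm (u n - l) < e.
Proof.
move=> uC.
have ptC x (e : R) : 0 < e -> exists N, forall m n,
    (N <= m)%N -> (N <= n)%N -> cnorm (u m x - u n x) < e.
  move=> /uC[N HN]; exists N => m n Nm Nn.
  exact: le_lt_trans (CI_norm_ge (u m - u n) x) (HN _ _ Nm Nn).
have [g gP] := choice
  (fun x => @cnorm_complete _ B (fun n => u n x) (@ptC x)).
have unif e : 0 < e ->
    exists N, forall n, (N <= n)%N -> forall x, cnorm (u n x - g x) <= e.
  move=> e0; have e20 : 0 < e / 2 by rewrite divr_gt0.
  have [N HN] := uC _ e20; exists N => n Nn x.
  have [N' HN'] := gP x _ e20; pose m := maxn N N'.
  apply: (le_trans (cnorm_tri _ (u m x) _)).
  rewrite [e]splitr; apply: lerD; apply: ltW.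
    apply: le_lt_trans (CI_norm_ge (u n - u m) x) (HN _ _ Nn _).
    exact: leq_maxl.
  by apply: HN'; exact: leq_maxr.
have gc : continuous g.
  move=> x; have FF : Filter (nbhs x) := nbhs_filter x.
apply/cvg_cnormP => e e0.
  have e40 : 0 < e / 4 by rewrite divr_gt0.
  have [N HN] := unif _ e40.
  have /cvg_cnormP/(_ _ e40) := @CI_cts (u N) x.
  apply: filterS => y uxy.
  have H1 := HN N (leqnn N) x; have H2 := HN N (leqnn N) y.
  have H3 := cnorm_tri (g x) (u N x) (g y).
  have H4 := cnorm_tri (u N x) (u N y) (g y).
  move: H1; rewrite cnormB => H1; lra.
exists (CI_mk gc) => e e0.
have e20 : 0 < e / 2 by rewrite divr_gt0.
have [N HN] := unif _ e20; exists N => n Nn.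
apply: (@le_lt_trans _ _ (e / 2)); first by apply: CI_norm_le => x; exact: HN.
by rewrite ltr_pdivrMr // ltr_pMr // ltr1n.
Qed.

HB.instance Definition _ := isCStar.Build R (CI B)
  CI_starD CI_starZ CI_starM CI_starK CI_normD CI_normZ CI_norm0_eq0
  CI_normM CI_norm_starM CI_complete.

End continuous_functions.

Section elements.
Variables (R : realType) (A : cstarAlgType R).
Implicit Types (s u : A) (P X : set A).

Definition is_isometry s := star s * s = 1.

Definition is_unitary u := star u * u = 1 /\ u * star u = 1.

Record is_cstar_subalgebra P : Prop := {
  subalg_1 : P 1 ;
  subalg_D : forall x y, P x -> P y -> P (x + y) ;
  subalg_Z : forall (c : R[i]) x, P x -> P (c *: x) ;
  subalg_M : forall x y, P x -> P y -> P (x * y) ;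
  subalg_star : forall x, P x -> P (star x) ;
  subalg_closed : closed P
}.

(* C^*(X) is the whole algebra *)
Definition generates X :=
  forall P, is_cstar_subalgebra P -> X `<=` P -> P = [set: A].

Definition cuntz_pair s1 s2 :=
  [/\ is_isometry s1, is_isometry s2 & s1 * star s1 + s2 * star s2 = 1].

(* A = C^*(s1, s2), i.e. A is the Cuntz algebra O_2: all such A are canonically
   isomorphic, so universality need not be required. *)
Definition is_cuntz_algebra s1 s2 :=
  cuntz_pair s1 s2 /\ generates [set s1; s2].

End elements.

Definition is_automorphism (R : realType) (A : cstarAlgType R)
  (f : {starhom A -> A}) := bijective f.

(* B, generated by the copy j(A) of A and by the unitary v, is the crossed
   product of A by the action of Z generated by sigma.  Uniqueness of psi
   follows from cpZ_generates. *)
Record is_crossed_product_Z (R : realType) (A : cstarAlgType R)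
    (sigma : {starhom A -> A})
    (B : cstarAlgType R) (j : {starhom A -> B}) (v : B) : Prop := {
  cpZ_inj : injective j ;
  cpZ_unitary : is_unitary v ;
  cpZ_covariant : forall a, v * j a * star v = j (sigma a) ;
  cpZ_generates : generates (range j `|` [set v]) ;
  cpZ_universal : forall (D : cstarAlgType R) (pi : {starhom A -> D}) (u : D),
    is_unitary u -> (forall a, u * pi a * star u = pi (sigma a)) ->
    exists psi : {starhom B -> D}, (forall a, psi (j a) = pi a) /\ psi v = u
}.

(* C is the universal C*-algebra generated by a Cuntz pair e(s1), e(s2), where
   e embeds A = C^*(s1, s2), and by a unitary w with w^2 = 1 exchanging the two
   isometries: the crossed product of O_2 by the flip action of Z/2. *)
Record is_flip_crossed_product_Z2 (R : realType) (A : cstarAlgType R)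
    (s1 s2 : A)
    (C : cstarAlgType R) (e : {starhom A -> C}) (w : C) : Prop := {
  cpZ2_inj : injective e ;
  cpZ2_unitary : is_unitary w ;
  cpZ2_square : w ^+ 2 = 1 ;
  cpZ2_flip : w * e s1 = e s2 * w ;
  cpZ2_generates : generates [set e s1; e s2; w] ;
  cpZ2_universal : forall (D : cstarAlgType R) (t1 t2 u : D),
    cuntz_pair t1 t2 -> is_unitary u -> u ^+ 2 = 1 -> u * t1 = t2 * u ->
    exists psi : {starhom C -> D},
      [/\ psi (e s1) = t1, psi (e s2) = t2 & psi w = u]
}.

(* The operations, star and norm of the *-subalgebra P are those of D. *)
Definition star_isomorphic_to (R : realType) (B D : cstarAlgType R)
    (P : set D) :=
  exists phi : {starhom B -> D}, injective phi /\ range phi = P.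

(* Main.v *)
From Pilot Require Import Defs.
From HB Require Import structures.
From mathcomp Require Import all_boot all_order all_algebra.
From mathcomp Require Import all_classical all_reals all_analysis.
From mathcomp Require Import cyclic separable cyclotomic.
From mathcomp Require Import complex zify ring lra.
Import Order.TTheory GRing.Theory Num.Theory numFieldNormedType.Exports.
Set Implicit Arguments.
Unset Strict Implicit.
Unset Printing Implicit Defensive.
Local Open Scope classical_set_scope.
Local Open Scope complex_scope.
Local Open Scope ring_scope.

(** Write [a] for [j a].  Since [sigma] is an involution, [V ^+ 2] is central
    in the crossed product by [Z], and imposing [V ^+ 2 = exp (i pi t)] amounts
    to [V = z w] with [z = exp (i pi t / 2)] and [w] a self-adjoint unitary
    implementing [sigma]: every fibre is a copy of [C].  Going once around the
    circle changes the sign of [z], which is the effect of [sigmahat] on [C],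
    hence the gluing condition.  Universality turns this into a morphism
    [phi : B -> CI C] sending [a] to the constant function [e a] and [V] to
    [t |-> z(t) w]; it remains to see that [phi] is isometric and that its range
    contains every function satisfying the gluing condition.

    Isometry ([phi_isometric]).  A Laurent sum [x] of degree at most [d] has
    [2 d + 1] coefficients [a_n], and each of them is recovered from [phi x] by
    averaging over roots of unity, so that [cnorm x <= (2 d + 1) cnorm (phi x)]
    ([laurent_crude_le]).  The powers of [star x * x] are again Laurent sums,
    with degree growing linearly in the exponent, so that the C*-identity
    removes the factor ([cnorm_le_of_powers]).  Laurent sums are dense.

    The estimate of the coefficients uses
    [cnorm (j a) <= cnorm a = cnorm (e a)], that is, two general facts about
    *-homomorphisms.  They are contractive ([starhom_contractive]), because a
    self-adjoint element of norm less than 1 is the real part of a unitary.  The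
    injective ones are isometric ([injective_starhom_isometric]), because
    polynomials obey [cnorm (p(y)) <= sup |p|] over an interval that contains
    [[- cnorm y, cnorm y]] in its interior, by the same combination of Fourier
    coefficients and powers, and so the continuous function [min(s^2, r^2)] can
    be applied to a self-adjoint element.

    Range ([twisted_in_range]).  Every element of [C] is [e a + e b w], where
    [sigmahat] separates the two terms.  For a function satisfying the gluing
    condition, [a] and [conj z * b] are functions of [exp (i pi t)], hence are
    uniformly approximated by discrete Fejer sums with values in [e A]
    ([fejer_approx]), and these lie in the range, which is closed. *)

(** * The norm, and limits of sequences *)

Section NormBasics.
Variables (R : realType) (A : cstarAlgType R).
Implicit Types x y u : A.

Lemma star0 : star (0 : A) = 0.
Proof. by rewrite -(scale0r (0 : A)) starZ conjC0 !scale0r. Qed.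

Lemma starB x y : star (x - y) = star x - star y.
Proof. by rewrite starD starN. Qed.

Lemma starX x n : star (x ^+ n) = star x ^+ n.
Proof.
elim: n => [|n IH]; first by rewrite !expr0 star1.
by rewrite exprS starM IH exprSr.
Qed.

Lemma star_sum (I : Type) (r : seq I) (P : pred I) (F : I -> A) :
  star (\sum_(i <- r | P i) F i) = \sum_(i <- r | P i) star (F i).
Proof. exact: (big_morph star (@starD R A) star0). Qed.

Lemma cnorm1 : cnorm (1 : A) = 1.
Proof.
have n0 : cnorm (1 : A) != 0.
  by apply/eqP => /cnorm0_eq0/eqP; rewrite oner_eq0.
by apply: (mulfI n0); rewrite mulr1 -expr2 -cnorm_starM star1 mulr1.
Qed.

Lemma cnormX x n : cnorm (x ^+ n) <= cnorm x ^+ n.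
Proof.
elim: n => [|n IH]; first by rewrite !expr0 cnorm1.
rewrite !exprS (le_trans (cnormM _ _)) //.
by rewrite ler_wpM2l ?cnorm_ge0.
Qed.

Lemma cnorm_sum (I : Type) (r : seq I) (P : pred I) (F : I -> A) :
  cnorm (\sum_(i <- r | P i) F i) <= \sum_(i <- r | P i) cnorm (F i).
Proof.
elim/big_ind2 : _ => [|x a y b xa yb|//]; first by rewrite cnorm0.
by rewrite (le_trans (cnormD _ _)) // lerD.
Qed.

Lemma cnormZR (r : R) x : cnorm (r%:C *: x) = `|r| * cnorm x.
Proof. by rewrite cnormZr normc_def /= expr0n addr0 sqrtr_sqr. Qed.

Lemma cnormZ1 (c : R[i]) x : `|c| = 1 -> cnorm (c *: x) = cnorm x.
Proof. by move=> c1; rewrite cnormZr c1 mul1r. Qed.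

Lemma cnorm_isoM u x : star u * u = 1 -> cnorm (u * x) = cnorm x.
Proof.
move=> u1; apply/eqP; rewrite -(@eqrXn2 _ 2) ?cnorm_ge0 //.
by rewrite -!cnorm_starM starM mulrA -(mulrA (star x)) u1 mulr1.
Qed.

Lemma cnorm_Mcoiso u x : u * star u = 1 -> cnorm (x * u) = cnorm x.
Proof.
move=> u1; rewrite -cnorm_star starM cnorm_isoM ?cnorm_star //.
by rewrite starK.
Qed.

Lemma cnorm_iso u : star u * u = 1 -> cnorm u = 1.
Proof. by move=> u1; rewrite -[u]mulr1 cnorm_isoM // cnorm1. Qed.

(** Iterating the C*-identity; this replaces the spectral radius formula. *)
Lemma cnorm_sa_expn2 x k : star x = x -> 
  cnorm (x ^+ (2 ^ k)) = cnorm x ^+ (2 ^ k).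
Proof.
move=> xs; elim: k => [|k IH]; first by rewrite !expn0 !expr1.
rewrite expnS mulnC !exprM -IH -cnorm_starM.
by rewrite starX xs -expr2.
Qed.

Lemma unitary_exp u n : Defs.is_unitary u -> Defs.is_unitary (u ^+ n).
Proof.
move=> [u1 u2]; split; rewrite starX -exprMn_comm ?u1 ?u2 ?expr1n //;
  by rewrite /GRing.comm u1 u2.
Qed.

Lemma unitary_star u : Defs.is_unitary u -> Defs.is_unitary (star u).
Proof. by move=> [u1 u2]; split; rewrite starK. Qed.

End NormBasics.

Section Limits.
Variables (R : realType) (A : cstarAlgType R).
Implicit Types (u v : nat -> A) (x y l : A).

Lemma cnorm_cvgP u l :
  u @ \oo --> l <->
  forall e : R, 0 < e -> exists N, forall n, (N <= n)%N -> cnorm (u n - l) < e.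
Proof.
split.
  move=> /cvg_cnormP H e e0; have [N _ HN] := H e e0; exists N => n Nn.
  by rewrite cnormB; apply: HN.
move=> H; apply/cvg_cnormP => e e0; have [N HN] := H e e0; exists N => //= n Nn.
by rewrite cnormB; apply: HN.
Qed.

Lemma cstar_cauchy_cvg u :
  (forall e : R, 0 < e -> exists N, forall m n,
      (N <= m)%N -> (N <= n)%N -> cnorm (u m - u n) < e) ->
  exists l, u @ \oo --> l.
Proof. by move=> /cnorm_complete[l H]; exists l; apply/cnorm_cvgP. Qed.

Lemma cstar_cvg_uniq u l l' : u @ \oo --> l -> u @ \oo --> l' -> l = l'.
Proof.
have HH : hausdorff_space A by exact: norm_hausdorff.
exact: (cvg_unique HH).
Qed.

Lemma cvg_cnorm u l : u @ \oo --> l -> cnorm (u n) @[n --> \oo] --> cnorm l.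
Proof.
move=> /cvg_cnormP ul; apply/cvgrPdist_lt => e e0;
  apply: filterS (ul e e0) => n.
exact/le_lt_trans/cnorm_dist.
Qed.

Lemma cvg_star u l : u @ \oo --> l -> star (u n) @[n --> \oo] --> star l.
Proof.
move=> /cvg_cnormP ul; apply/cvg_cnormP => e e0; apply: filterS (ul e e0) => n.
by rewrite -starB cnorm_star.
Qed.

Lemma cvg_mul_cstar u v x y : u @ \oo --> x -> v @ \oo --> y ->
  u n * v n @[n --> \oo] --> x * y.
Proof.
move=> ux vy; apply/cvg_cnormP => e e0.
have H : (cnorm (x - u n) * cnorm (v n) + cnorm x * cnorm (y - v n))
    @[n --> \oo] --> cnorm (x - x) * cnorm y + cnorm x * cnorm (y - y).
  apply: cvgD; apply: cvgM; try exact: cvg_cst; try exact: cvg_cnorm;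
    by apply: cvg_cnorm; apply: cvgB => //; exact: cvg_cst.
rewrite !subrr cnorm0 mul0r mulr0 addr0 in H.
move/cvgrPdist_lt : H => /(_ e e0); apply: filterS => n.
rewrite sub0r normrN; apply: le_lt_trans.
rewrite ger0_norm ?addr_ge0 ?mulr_ge0 ?cnorm_ge0 //.
have -> : x * y - u n * v n = (x - u n) * v n + x * (y - v n).
  by rewrite mulrBl mulrBr [RHS]addrC addrA subrK.
by rewrite (le_trans (cnormD _ _)) // lerD ?cnormM.
Qed.

(** The form in which completeness serves the square root iteration. *)
Lemma geometric_cvg u (q : R) : 0 <= q < 1 ->
  (forall n, cnorm (u n.+1 - u n) <= q ^+ n) -> exists l, u @ \oo --> l.
Proof.
move=> /andP[q0 q1] H; apply: cstar_cauchy_cvg => e e0.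
have dist n k : (1 - q) * cnorm (u (n + k)%N - u n) <= q ^+ n.
  suff : (1 - q) * cnorm (u (n + k)%N - u n) <= q ^+ n - q ^+ (n + k).
    by move=> /le_trans; apply; rewrite gerBl exprn_ge0.
  elim: k => [|k IH]; first by rewrite addn0 !subrr cnorm0 mulr0.
  have := ler_wpM2l (_ : 0 <= 1 - q)
    (cnorm_tri (u (n + k.+1)%N) (u (n + k)%N) (u n)).
  rewrite subr_ge0 (ltW q1) => /(_ isT) /le_trans; apply.
  have := ler_wpM2l (_ : 0 <= 1 - q) (H (n + k)%N).
  rewrite subr_ge0 (ltW q1) => /(_ isT); rewrite addnS exprS mulrDr.
  by move: IH; lra.
have q10 : 0 < 1 - q by rewrite subr_gt0.
have e1 : 0 < (1 - q) * (e / 2) by rewrite mulr_gt0 // divr_gt0.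
have /cvgrPdist_lt/(_ _ e1)[N _ HN] : q ^+ n @[n --> \oo] --> 0.
  by apply: cvg_expr; rewrite ger0_norm.
have {HN} HN : q ^+ N < (1 - q) * (e / 2).
  have := HN N (leqnn N); rewrite sub0r normrN ger0_norm ?exprn_ge0 //.
exists N => m n Nm Nn.
have close k : (N <= k)%N -> cnorm (u k - u N) < e / 2.
  move=> Nk; rewrite -(ltr_pM2l q10) (le_lt_trans _ HN) //.
  by rewrite -{1}(subnKC Nk) dist.
rewrite (le_lt_trans (cnorm_tri _ (u N) _)) // (splitr e) ltrD ?close //.
by rewrite cnormB close.
Qed.

End Limits.

(** * *-homomorphisms are contractive *)

Section Contractive.
Variable R : realType.

Section Sqrt.
Variable A : cstarAlgType R.

Lemma half2 (x : A) : (2^-1 : R)%:C *: (x + x) = x.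
Proof.
rewrite scalerDr -scalerDl -rmorphD.
have -> : 2^-1 + 2^-1 = 1 :> R by lra.
by rewrite rmorph1 scale1r.
Qed.

Lemma star_realZ (r : R) (x : A) : star (r%:C *: x) = r%:C *: star x.
Proof. by rewrite starZ conj_Creal // complex_real. Qed.

(** If [s = 1 - r] then [s ^ 2 = 1 - h] means [r = (h + r ^ 2) / 2].  The
    iteration of the right-hand side from 0 stays in the ball of radius
    [cnorm h < 1], where it is a contraction, and it produces elements that
    commute with whatever commutes with [h]. *)
Lemma sqrt_one_sub (h : A) : star h = h -> cnorm h < 1 ->
  exists s : A, [/\ star s = s, s * s = 1 - h &
    forall x, x * h = h * x -> x * s = s * x].
Proof.
move=> hs h1; pose c := (2^-1 : R)%:C.
pose r : nat -> A := fix r n : A :=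
  if n is n'.+1 then c *: (h + r n' * r n') else 0.
pose q := cnorm h; have q0 : 0 <= q := cnorm_ge0 h.
have cn x : cnorm (c *: x) = 2^-1 * cnorm x.
  by rewrite cnormZR ger0_norm // invr_ge0.
have rq n : cnorm (r n) <= q.
  elim: n => [|n IH] /=; first by rewrite cnorm0.
  rewrite cn; have := cnormD h (r n * r n); have := cnormM (r n) (r n).
  have := ler_pM (cnorm_ge0 _) (cnorm_ge0 _) IH IH.
  have := ler_piMr q0 (ltW h1); rewrite -/q; lra.
have rC n : cnorm (r n.+1 - r n) <= q ^+ n.
  elim: n => [|n IH].
    rewrite /= mul0r addr0 subr0 expr0 cn -/q; move: h1; rewrite -/q; lra.
  rewrite [r n.+2]/= [r n.+1 in X in _ - X]/= -/(r n.+1) -scalerBr cn.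
  have -> : h + r n.+1 * r n.+1 - (h + r n * r n) =
      r n.+1 * (r n.+1 - r n) + (r n.+1 - r n) * r n.
    by rewrite mulrBr mulrBl addrA subrK opprD addrACA subrr add0r.
  have := cnormD (r n.+1 * (r n.+1 - r n)) ((r n.+1 - r n) * r n).
  have := cnormM (r n.+1) (r n.+1 - r n); have := cnormM (r n.+1 - r n) (r n).
  have := ler_pM (cnorm_ge0 _) (cnorm_ge0 _) (rq n.+1) IH.
  have := ler_pM (cnorm_ge0 _) (cnorm_ge0 _) IH (rq n).
  by rewrite exprS; lra.
have [l rl] : exists l : A, r @ \oo --> l.
  by apply: (@geometric_cvg _ _ r q) rC; rewrite q0 h1.
have ls : star l = l.
  have rs n : star (r n) = r n.
    by elim: n => [|n IH] /=; rewrite ?star0 // star_realZ starD hs starM IH.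
  by apply: (cstar_cvg_uniq (cvg_star rl)); under eq_fun do rewrite rs.
have lE : l = c *: (h + l * l).
  apply: (@cstar_cvg_uniq _ _ (fun n => r n.+1)); first by rewrite cvg_shiftS.
  apply: (@cvgZl_tmp _ _ _ _ _ _ _ (h + l * l)).
  by apply: cvgD; [exact: cvg_cst|exact: cvg_mul_cstar].
exists (1 - l); split=> [||x xh]; first by rewrite starB star1 ls.
  have hl : h + l * l = l + l.
    by rewrite [in RHS]lE -scalerDr half2.
  rewrite mulrBl !mulrBr !mul1r mulr1 -[h](addrK (l * l)) hl.
  by rewrite !opprD !opprK !addrA.
have xr n : x * r n = r n * x.
  elim: n => [|n IH] /=; first by rewrite mulr0 mul0r.
  by rewrite -scalerAr -scalerAl mulrDr mulrDl xh mulrA IH -mulrA IH mulrA.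
have xl : x * l = l * x.
  apply: (cstar_cvg_uniq (cvg_mul_cstar (@cvg_cst _ x _ _ _) rl)).
  under eq_fun do rewrite xr.
  by apply: cvg_mul_cstar => //; exact: cvg_cst.
by rewrite mulrBr mulrBl mulr1 mul1r xl.
Qed.

(** The unitary is [y + i sqrt (1 - y ^ 2)]. *)
Lemma real_part_unitary (y : A) : star y = y -> cnorm y < 1 ->
  exists u : A, Defs.is_unitary u /\ y = (2^-1 : R)%:C *: (u + star u).
Proof.
move=> ys y1.
have y2 : cnorm (y * y) < 1.
  by rewrite (le_lt_trans (cnormM _ _)) // mulr_ilt1 ?cnorm_ge0.
have [|s [ss s2 sC]] := @sqrt_one_sub (y * y) _ y2; first by rewrite starM ys.
have sy : y * s = s * y by apply: sC; rewrite mulrA.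
have us : star (y + 'i *: s) = y - 'i *: s.
  rewrite starD starZ ys ss -scaleNr; congr (_ + _ *: _).
  by apply/eqP; rewrite eq_complex /= oppr0 !eqxx.
have ii : ('i : R[i]) * 'i = -1 by rewrite -expr2 sqr_i.
exists (y + 'i *: s); split; last first.
  by rewrite us addrACA subrr addr0 half2.
have yis : (y - 'i *: s) * (y + 'i *: s) = 1.
  rewrite mulrDl !mulrDr !mulNr -!scalerAl -!scalerAr scalerA ii sy.
  by rewrite scaleN1r opprK s2 -addrA addNKr addrC subrK.
have siy : (y + 'i *: s) * (y - 'i *: s) = 1.
  rewrite mulrDl !mulrDr !mulrN -!scalerAl -!scalerAr scalerA ii sy.
  by rewrite scaleN1r opprK s2 -addrA addKr addrC subrK.
by split; rewrite us.
Qed.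

End Sqrt.

Variables (A D : cstarAlgType R) (f : {starhom A -> D}).

Lemma starhom_isometry_elt (u : A) : star u * u = 1 -> cnorm (f u) = 1.
Proof.
by move=> u1; apply: cnorm_iso; rewrite -star_morph -rmorphM u1 rmorph1.
Qed.

Lemma starhom_realZ (r : R) (x : A) : f (r%:C *: x) = r%:C *: f x.
Proof. by rewrite linearZ. Qed.

(** A morphism maps unitaries to unitaries, hence real parts of unitaries to
    elements of norm at most 1; the C*-identity reduces to the self-adjoint
    case. *)
Lemma starhom_contractive (x : A) : cnorm (f x) <= cnorm x.
Proof.
have sa (h : A) : star h = h -> cnorm (f h) <= cnorm h.
  move=> hs; apply/ler_addgt0Pr => d d0; set c := cnorm h + d.
  have c0 : 0 < c by rewrite ltr_wpDl ?cnorm_ge0.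
  have [||u [[u1 u2] hu]] := @real_part_unitary A ((c^-1)%:C *: h).
  - by rewrite star_realZ hs.
  - by rewrite cnormZR gtr0_norm ?invr_gt0 // mulrC ltr_pdivrMr ?mul1r // ltrDl.
  have {hu} : cnorm (f ((c^-1)%:C *: h)) <= 1.
    rewrite hu starhom_realZ raddfD cnormZR ger0_norm ?invr_ge0 //.
    have fu := starhom_isometry_elt u1.
    have fus : cnorm (f (star u)) = 1 by apply: starhom_isometry_elt;
      rewrite starK.
    have := cnormD (f u) (f (star u)); rewrite fu fus; lra.
  rewrite starhom_realZ cnormZR gtr0_norm ?invr_gt0 //.
  by rewrite mulrC ler_pdivrMr // mul1r.
rewrite -(@ler_pXn2r R 2) ?nnegrE ?cnorm_ge0 // -!cnorm_starM
  -star_morph -rmorphM.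
by apply: sa; rewrite starM starK.
Qed.

Lemma starhom_cvg (u : nat -> A) (l : A) :
  u @ \oo --> l -> f (u n) @[n --> \oo] --> f l.
Proof.
move=> /cvg_cnormP ul; apply/cvg_cnormP => e e0; apply: filterS (ul e e0) => n.
by rewrite -raddfB; exact/le_lt_trans/starhom_contractive.
Qed.

Lemma starhom_continuous : continuous f.
Proof.
move=> x; have FF : Filter (nbhs x) := nbhs_filter x.
apply/cvg_cnormP => e e0; have /cvg_cnormP/(_ e e0) := @cvg_id _ (nbhs x).
by apply: filterS => y; rewrite -raddfB; exact/le_lt_trans/starhom_contractive.
Qed.

End Contractive.

(** * Growth of powers and Fourier coefficients *)

(** If [a / b = 1 + t] with [t > 0], then squaring Bernoulli's inequality gives
    [(a / b) ^ (2 n) >= (n t) ^ 2], which outgrows any linear bound. *)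
Lemma expn_growth_le (R : realType) (a b c d : R) : 0 <= a -> 0 <= b ->
  (forall k, a ^+ (2 ^ k) <= (c * (2 ^ k)%:R + d) * b ^+ (2 ^ k)) -> a <= b.
Proof.
move=> a0 b0 H; rewrite leNgt; apply/negP => ba.
have [bz|bn0] := eqVneq b 0.
  by have := H 0%N; rewrite expn0 !expr1 bz mulr0 leNgt -{1}bz ba.
have bp : 0 < b by rewrite lt_neqAle eq_sym bn0.
pose q := a / b; pose t := q - 1.
have t0 : 0 < t by rewrite subr_gt0 ltr_pdivlMr // mul1r.
have Hq k : q ^+ (2 ^ k) <= c * (2 ^ k)%:R + d.
  by rewrite expr_div_n ler_pdivrMr ?exprn_gt0.
have bern n : 1 + n%:R * t <= q ^+ n.
  elim: n => [|n IH]; first by rewrite mul0r addr0 expr0.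
  have q0 : 0 <= q by apply: divr_ge0.
  have := ler_wpM2l q0 IH; rewrite -exprS; apply: le_trans.
  have -> : q = 1 + t by rewrite /t addrC subrK.
  rewrite -natr1; have : 0 <= n%:R * t * t by rewrite !mulr_ge0 // ltW.
  by lra.
pose K := `|c| + `|c| + `|d|.
have HK k : (2 ^ k)%:R * (t * t) <= K.
  set n := (2 ^ k)%N; have n1 : 1 <= n%:R :> R by rewrite ler1n expn_gt0.
  have n0 : 0 < n%:R :> R by apply: lt_le_trans n1.
  rewrite -(ler_pM2l n0); have := Hq k.+1.
  rewrite expnS mulnC exprM -/n.
  have nt : n%:R * t <= q ^+ n by apply: le_trans (bern n); rewrite lerDr.
  have nt0 : 0 <= n%:R * t by rewrite mulr_ge0 // ltW.
  have := ler_pM nt0 nt0 nt nt; rewrite -expr2 natrM.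
  have := ler_norm d; have := ler_norm c; rewrite /K.
  move=> /(ler_wpM2r (ltW n0)) cn dd.
  have : `|d| <= `|d| * n%:R by rewrite ler_peMr.
  by lra.
have tt0 : 0 < t * t by exact: mulr_gt0.
have := HK (Num.bound (K / (t * t))).
rewrite -ler_pdivlMr // leNgt => /negP; apply.
apply: lt_trans (_ : (Num.bound (K / (t * t)))%:R < _).
  by rewrite archi_boundP // divr_ge0 ?(ltW tt0) // /K !addr_ge0.
by rewrite ltr_nat ltn_expl.
Qed.

(** The C*-identity turns a bound on the powers that is only correct up to a
    factor of linear growth into the sharp bound. *)
Lemma cnorm_le_of_powers (R : realType) (A : cstarAlgType R) (x : A)
  (M c d : R) :
  0 <= M ->
  (forall m, cnorm ((star x * x) ^+ m) <= (c * m%:R + d) * (M ^+ 2) ^+ m) ->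
  cnorm x <= M.
Proof.
move=> M0 H; rewrite -(@ler_pXn2r R 2) ?nnegrE ?cnorm_ge0 // -cnorm_starM.
apply: (@expn_growth_le _ _ _ c d); rewrite ?cnorm_ge0 ?exprn_ge0 // => k.
by rewrite -cnorm_sa_expn2 ?starM ?starK.
Qed.

Section Fourier.
Variable R : realType.

Lemma prim_root_exists n : (n > 0)%N -> {z : R[i] | n.-primitive_root z}.
Proof.
move=> n0; apply/sigW.
have [rs rsE] := closed_field_poly_normal ('X^n - 1 : {poly R[i]}).
rewrite lead_coefXnsubC // scale1r in rsE.
have unity : all n.-unity_root rs.
  by apply/allP => z; rewrite -root_prod_XsubC -rsE.
have simple : uniq rs.
  by rewrite -separable_prod_XsubC -rsE separable_Xn_sub_1 // pnatr_eq0 -lt0n.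
have full : (n <= size rs)%N.
  by rewrite -ltnS -(size_prod_XsubC rs id) -rsE size_XnsubC.
by have /hasP[z _ zP] := has_prim_root n0 unity simple full; exists z.
Qed.

Lemma prim_root_norm n (z : R[i]) : (0 < n)%N -> z ^+ n = 1 -> `|z| = 1.
Proof.
move=> n0 zn; apply/eqP; rewrite -(@pexpr_eq1 _ _ n) ?normr_ge0 //.
by rewrite -normrX zn normr1.
Qed.

(** Orthogonality of the characters of the group of [N]-th roots of unity. *)
Lemma prim_root_ortho N (z : R[i]) (m n : nat) : N.-primitive_root z ->
  (m < N)%N -> (n < N)%N ->
  \sum_(k < N) (z ^+ k) ^+ m * ((z ^+ k)^*) ^+ n = (if m == n then N%:R else 0).
Proof.
move=> zP mN nN; have N0 := prim_order_gt0 zP.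
have z1 : `|z| = 1 by apply: (@prim_root_norm N) => //; exact: prim_expr_order.
have z0 : z != 0 by rewrite -normr_eq0 z1 oner_eq0.
have zc : z^* = z^-1 by rewrite invC_norm z1 expr1n invr1 mul1r.
pose o := z ^+ m / z ^+ n.
have oE k : (z ^+ k) ^+ m * ((z ^+ k)^*) ^+ n = o ^+ k.
  by rewrite /o rmorphXn /= zc !exprVn expr_div_n -!exprM ![(_ * k)%N]mulnC.
rewrite (eq_bigr (fun k : 'I_N => o ^+ k)) => [|k _]; last exact: oE.
have [mn|mn] := eqVneq m n.
  rewrite /o mn divff ?expf_neq0 //.
  rewrite (eq_bigr (fun _ => 1)) => [|k _]; last by rewrite expr1n.
  by rewrite sumr_const card_ord.
have o1 : o != 1.
  apply: contra mn => /eqP o1.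
  have /eqP : z ^+ m = z ^+ n.
    by rewrite -[RHS]mul1r -o1 /o divfK // expf_neq0.
  by rewrite (eq_prim_root_expr zP) !modn_small.
have oN : o ^+ N = 1.
  by rewrite /o expr_div_n -!exprM ![(_ * N)%N]mulnC !exprM (prim_expr_order zP)
    !expr1n divr1.
apply: (mulfI (_ : o - 1 != 0)); first by rewrite subr_eq0.
by rewrite -subrX1 oN subrr mulr0.
Qed.

Variable A : cstarAlgType R.

(** Averaging the sum against [s ^ - n] over the [N]-th roots of unity extracts
    the [n]-th coefficient exactly, as there are [N] terms. *)
Lemma fourier_coef_le N (c : nat -> A) (M : R) :
  (forall s : R[i], `|s| = 1 -> cnorm (\sum_(m < N) s ^+ m *: c m) <= M) ->
  forall n, (n < N)%N -> cnorm (c n) <= M.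
Proof.
move=> H n nN; have N0 : (0 < N)%N by apply: leq_ltn_trans nN.
have [z zP] := prim_root_exists N0.
have z1 : `|z| = 1 by apply: (@prim_root_norm N) => //; exact: prim_expr_order.
have cE : N%:R *: c n =
    \sum_(k < N) ((z ^+ k)^*) ^+ n *: \sum_(m < N) (z ^+ k) ^+ m *: c m.
  under eq_bigr do rewrite scaler_sumr.
  rewrite exchange_big /= (bigD1 (Ordinal nN)) //= [X in _ + X]big1 => [|m mn].
    rewrite addr0; under eq_bigr do rewrite scalerA mulrC.
    by rewrite -scaler_suml prim_root_ortho ?eqxx.
  under eq_bigr do rewrite scalerA mulrC.
  by rewrite -scaler_suml prim_root_ortho // ifN ?scale0r.
have Np : 0 < N%:R :> R by rewrite ltr0n.
rewrite -(ler_pM2l Np).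
have -> : N%:R * cnorm (c n) = cnorm (N%:R *: c n).
  by rewrite -(rmorph_nat (real_complex R)) cnormZR gtr0_norm.
rewrite cE (le_trans (cnorm_sum _ _ _)) //.
apply: le_trans (_ : \sum_(k < N) M <= _).
  apply: ler_sum => k _; rewrite cnormZ1.
    by apply: H; rewrite normrX z1 expr1n.
  by rewrite normrX norm_conjC normrX z1 !expr1n.
by rewrite sumr_const card_ord mulr_natl.
Qed.

End Fourier.

(** * Polynomials in a self-adjoint element *)

Section PolynomialCalculus.
Variables (R : realType) (A : cstarAlgType R).
Implicit Types (p q : {poly R[i]}) (x y u : A).

Lemma horner_alg_coef_wide n p x : (size p <= n)%N ->
  horner_alg x p = \sum_(k < n) p`_k *: x ^+ k.
Proof.
move=> pn; rewrite -{1}(coefK p) poly_def linear_sum /=.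
rewrite (big_ord_widen n (fun k => horner_alg x (p`_k *: 'X^k))) //.
rewrite big_mkcond /=; apply: eq_bigr => k _; case: ltnP => kp.
  by rewrite linearZ /= rmorphXn /= horner_algX mulr_algl.
by rewrite nth_default // scale0r.
Qed.

Lemma horner_alg_scalar p (s : R[i]) : horner_alg (s *: 1 : A) p = p.[s] *: 1.
Proof.
rewrite (horner_alg_coef_wide _ (leqnn _)) horner_coef scaler_suml.
by apply: eq_bigr => k _; rewrite exprZn expr1n scalerA.
Qed.

Lemma star_horner_alg p x : star x = x ->
  star (horner_alg x p) = horner_alg x (map_poly Num.conj p).
Proof.
move=> xs; rewrite (horner_alg_coef_wide _ (leqnn _)) star_sum.
rewrite (@horner_alg_coef_wide (size p)) ?size_poly //.
by apply: eq_bigr => k _; rewrite starZ starX xs coef_map.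
Qed.

(** With [y = c (u + u^-1)], [u ^ size p * p(y)] is a polynomial in [u]. *)
Definition laurent_lift (c : R[i]) p : {poly R[i]} :=
  \sum_(k < size p) (p`_k * c ^+ k) *: ('X^(size p - k) * ('X^2 + 1) ^+ k).

Lemma horner_laurent_lift (c : R[i]) p u v : u * v = 1 -> v * u = 1 ->
  horner_alg u (laurent_lift c p) =
  u ^+ size p * horner_alg (c *: (u + v)) p.
Proof.
move=> uv vu; rewrite (@horner_alg_coef_wide (size p) p) // /laurent_lift.
rewrite linear_sum mulr_sumr /=; apply: eq_bigr => k _.
have cu : GRing.comm u (u + v) by rewrite /GRing.comm mulrDr mulrDl uv vu.
rewrite linearZ rmorphM !rmorphXn rmorphD rmorphXn rmorph1 /= horner_algX
  mulr_algl.
rewrite exprZn -!scalerAr scalerA; congr (_ *: _).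
have -> : u ^+ 2 + 1 = u * (u + v) by rewrite mulrDr uv expr2.
rewrite exprMn_comm // mulrA -exprD subnK //; exact: ltnW.
Qed.

Lemma size_laurent_lift (c : R[i]) p :
  (size (laurent_lift c p) <= (size p + size p).+1)%N.
Proof.
apply: (leq_trans (size_sum _ _ _)); apply/bigmax_leqP => k _.
apply: (leq_trans (size_scale_leq _ _)).
apply: (leq_trans (size_polyMleq _ _)); rewrite size_polyXn addSn /=.
have := size_poly_exp_leq ('X^2 + 1 : {poly R[i]}) k.
have -> : size ('X^2 + 1 : {poly R[i]}) = 3 by rewrite size_XnaddC.
move=> H; have := leq_add (leqnn (size p - k)) H; move=> /leq_trans; apply.
rewrite /= addnS ltnS mul2n -addnn addnA subnK ?leq_add2l; exact: ltnW.
Qed.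

(** With [y = r (u + star u) / 2], the polynomial [u ^ d * p(y)] in [u] has at
    most [2 d + 1] coefficients.  On the unit circle [r (s + s^-1) / 2] runs
    through [[-r, r]], so that the bound on [p] bounds these coefficients. *)
Lemma horner_alg_crude_le p u (r M : R) : Defs.is_unitary u -> 0 <= r ->
  (forall s : R, `|s| <= r -> `|p.[s%:C]| <= M%:C) ->
  cnorm (horner_alg ((r / 2)%:C *: (u + star u)) p) <=
    (2 * (size p)%:R + 1) * M.
Proof.
move=> [u1 u2] r0 H; pose q := laurent_lift (r / 2)%:C p.
pose N := (size p + size p).+1.
have qN : (size q <= N)%N := size_laurent_lift _ _.
have coefs n : (n < N)%N -> cnorm (q`_n *: (1 : A)) <= M.
  apply: (@fourier_coef_le _ A N (fun n => q`_n *: 1)) => s s1.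
  have ss : s * s^* = 1 by rewrite -normCK s1 expr1n.
  have -> : \sum_(m < N) s ^+ m *: (q`_m *: (1 : A)) = horner_alg (s *: 1) q.
    rewrite (horner_alg_coef_wide _ qN); apply: eq_bigr => k _.
    by rewrite exprZn expr1n !scalerA mulrC.
  rewrite (@horner_laurent_lift _ p (s *: 1) (s^* *: 1)); last 2 first.
  - by rewrite -scalerAl mul1r scalerA ss scale1r.
  - by rewrite -scalerAl mul1r scalerA mulrC ss scale1r.
  rewrite exprZn expr1n -scalerAl mul1r cnormZ1 ?normrX ?s1 ?expr1n //.
  rewrite -scalerDl scalerA.
  have [t tr ->] : exists2 t : R, `|t| <= r & (r / 2)%:C * (s + s^*) = t%:C.
    exists (r * complex.Re s).
      rewrite normrM ger0_norm // ler_piMr //.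
      by have := normc_ge_Re s; rewrite s1 (_ : 1 = 1%:C) // lecR.
    case: (s) => a b; apply/eqP; rewrite eq_complex /=; apply/andP.
    by split; apply/eqP; field.
  by rewrite horner_alg_scalar cnormZr cnorm1 mulr1 -lecR RRe_real ?normr_real
    ?H.
rewrite -(@cnorm_isoM _ _ (u ^+ size p));
  last by case: (unitary_exp (size p) (conj u1 u2)).
rewrite -horner_laurent_lift // (horner_alg_coef_wide _ qN).
apply: (le_trans (cnorm_sum _ _ _)).
apply: le_trans (_ : \sum_(k < N) M <= _); last first.
  by rewrite sumr_const card_ord -[leLHS]mulr_natl /N -natr1 natrD; lra.
apply: ler_sum => k _.
have [k1 k2] := unitary_exp k (conj u1 u2).
by rewrite -[u ^+ k]mul1r scalerAl cnorm_Mcoiso // coefs.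
Qed.

(** The crude bound applied to the powers of [star (p(y)) * p(y)] loses only a
    factor that is linear in the exponent. *)
Lemma horner_alg_le p y (r M : R) : star y = y -> cnorm y < r ->
  (forall s : R, `|s| <= r -> `|p.[s%:C]| <= M%:C) ->
  cnorm (horner_alg y p) <= M.
Proof.
move=> ys yr H; have r0 : 0 < r := le_lt_trans (cnorm_ge0 _) yr.
have M0 : 0 <= M by rewrite -lecR (le_trans (normr_ge0 _) (H 0 _)) // normr0
  ltW.
have [||u [uU yu]] := @real_part_unitary _ A (r^-1%:C *: y).
- by rewrite star_realZ ys.
- by rewrite cnormZR gtr0_norm ?invr_gt0 // mulrC ltr_pdivrMr ?mul1r.
have {yu} yu : y = (r / 2)%:C *: (u + star u).
  by rewrite rmorphM -scalerA -yu scalerA -rmorphM divff ?rmorph1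
    ?scale1r // gt_eqF.
pose pp := map_poly Num.conj p * p.
apply: (@cnorm_le_of_powers _ _ _ M (2 * (size pp)%:R) 3) => // m.
rewrite star_horner_alg // -rmorphM -rmorphXn /= -/pp {1}yu.
have := @horner_alg_crude_le (pp ^+ m) u r ((M ^+ 2) ^+ m) uU (ltW r0) _.
move=> /(_ _)/le_trans; apply.
  move=> s /H ps; rewrite horner_exp normrX rmorphXn /= lerXn2r ?nnegrE //.
    by rewrite ler0c exprn_ge0.
  rewrite hornerM normrM rmorphXn expr2 ler_pM //.
  have {1}<- : Num.conj s%:C = s%:C by rewrite conj_Creal // complex_real.
  by rewrite horner_map norm_conjC ps.
rewrite ler_wpM2r ?exprn_ge0 //.
have := size_poly_exp_leq pp m.
move=> /(leq_trans)/(_ (leqnn _)) S.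
have : (size (pp ^+ m))%:R <= (size pp)%:R * m%:R + 1 :> R.
  by rewrite -natrM natr1 ler_nat (leq_trans S) // ltnS leq_mul2r leq_pred orbT.
by lra.
Qed.

End PolynomialCalculus.

(** * Injective *-homomorphisms are isometric *)

Section InjectiveIsometric.
Variable R : realType.
Implicit Types (s t : R) (n : nat).

(** The iteration [a |-> a + (t ^ 2 - a ^ 2) / 2], which increases to
    [|t|] on [[-1, 1]]. *)
Fixpoint abs_iter t n : R :=
  if n is n'.+1 then abs_iter t n' + (t ^+ 2 - abs_iter t n' ^+ 2) / 2 else 0.

Fixpoint abs_poly n : {poly R[i]} :=
  if n is n'.+1 then
    abs_poly n' + (2^-1)%:C%:P * ('X^2 - abs_poly n' ^+ 2)
  else 0.

Lemma horner_abs_poly n t : (abs_poly n).[t%:C] = (abs_iter t n)%:C.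
Proof.
elim: n => [|n IH] /=; first by rewrite horner0.
by rewrite !hornerE IH -!rmorphXn -rmorphB -rmorphM -rmorphD mulrC.
Qed.

(** The error [g] satisfies [0 <= g' <= g (1 - g / 2)], whose solutions decay
    like [2 / n]. *)
Lemma abs_iter_le t n : `|t| <= 1 ->
  0 <= abs_iter t n <= `|t| /\ `|t| - abs_iter t n <= 2 / n.+2%:R.
Proof.
move=> t1; elim: n => [|n [/andP[a0 at_] gG]] /=.
  by rewrite lexx normr_ge0 subr0 divff.
set x := `|t| in t1 at_ gG *; set a := abs_iter t n in a0 at_ gG *.
have -> : t ^+ 2 = x ^+ 2 by rewrite /x real_normK ?num_real.
set m : R := n.+2%:R in gG *.
have m2 : 2 <= m by rewrite ler_nat.
have -> : n.+3%:R = m + 1 by rewrite -natr1.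
set g := x - a in gG *.
have g0 : 0 <= g by rewrite subr_ge0.
have -> : a + (x ^+ 2 - a ^+ 2) / 2 = x - g * (1 - (x + a) / 2)
  by rewrite /g; field.
have w0 : 0 <= g * (1 - (x + a) / 2) by apply: mulr_ge0 => //; lra.
have a'0 : 0 <= (x - a) * (x + a) by apply: mulr_ge0; lra.
split; first by apply/andP; split; [rewrite /g; move: a'0; nra|lra].
set G := 2 / m in gG *.
have Gm : G * m = 2 by rewrite /G divfK // gt_eqF //; lra.
have mp : 0 < m by lra.
have G0 : 0 <= G by rewrite divr_ge0 //; lra.
have G1 : G <= 1 by rewrite ler_pdivrMr // mul1r.
have gx : g * g <= g * (x + a) by rewrite ler_wpM2l // /g; lra.
have gG2 : 0 <= (G - g) * (1 - (G + g) / 2) by apply: mulr_ge0; lra.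
have step : G * (1 - G / 2) <= 2 / (m + 1).
  rewrite ler_pdivlMr; last by lra.
  have -> : G * (1 - G / 2) * (m + 1) =
    2 - G * G / 2 + (G * m - 2) * (1 - G / 2).
    by field.
  rewrite Gm subrr mul0r addr0; have := mulr_ge0 G0 G0; lra.
apply: le_trans step; nra.
Qed.

(** Comes from [min(x, y) = (x + y - |x - y|) / 2] at [x = s ^ 2], [y = rho]. *)
Definition min_iter (rho : R) n s :=
  (s ^+ 2 + rho - abs_iter (s ^+ 2 - rho) n) / 2.

Definition min_poly (rho : R) n : {poly R[i]} :=
  (2^-1)%:C%:P * ('X^2 + rho%:C%:P - (abs_poly n \Po ('X^2 - rho%:C%:P))).

Lemma horner_min_poly (rho : R) n s :
  (min_poly rho n).[s%:C] = (min_iter rho n s)%:C.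
Proof.
rewrite /min_poly /min_iter !hornerE horner_comp !hornerE -rmorphXn -rmorphB.
by rewrite horner_abs_poly -rmorphD -rmorphB -rmorphM mulrC.
Qed.

Lemma min_iter_close (rho : R) n s : 0 <= rho <= 1 -> `|s| <= 1 ->
  `|min_iter rho n s - Num.min (s ^+ 2) rho| <= n.+1%:R^-1.
Proof.
move=> /andP[r0 r1] s1; rewrite minr_absE /min_iter.
have s20 : 0 <= s ^+ 2 by exact: sqr_ge0.
have s21 : s ^+ 2 <= 1 by rewrite -real_normK ?num_real // expr_le1.
have t1 : `|s ^+ 2 - rho| <= 1 by rewrite ler_norml; apply/andP; split; lra.
have [/andP[_ H1] H2] := abs_iter_le n t1.
set a := abs_iter _ _ in H1 H2 *; set x : R := `|s ^+ 2 - rho| in H1 H2 *.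
have -> : (s ^+ 2 + rho - a) / 2 - (s ^+ 2 + rho - x) / 2 = (x - a) / 2
  by field.
rewrite ger0_norm; last by rewrite divr_ge0 ?subr_ge0.
apply: (@le_trans _ _ n.+2%:R^-1); first by rewrite ler_pdivrMr // mulrC.
by rewrite lef_pV2 ?posrE ?ltr0n // ler_nat.
Qed.

Lemma inv_succ_small (e : R) : 0 < e -> exists N, forall n, (N <= n)%N ->
  n.+1%:R^-1 < e.
Proof.
move=> e0; exists (Num.bound e^-1) => n Nn.
rewrite -(invrK e) ltf_pV2 ?posrE ?invr_gt0 ?ltr0n //.
apply: lt_le_trans (_ : (Num.bound e^-1)%:R <= _).
  by rewrite archi_boundP // invr_ge0 ltW.
by rewrite ler_nat ltnW.
Qed.

Variables (A D : cstarAlgType R) (f : {starhom A -> D}).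

Lemma starhom_horner_alg (p : {poly R[i]}) (x : A) :
  f (horner_alg x p) = horner_alg (f x) p.
Proof.
rewrite !(horner_alg_coef_wide _ (leqnn _)) raddf_sum.
by apply: eq_bigr => k _; rewrite /= linearZ rmorphXn.
Qed.

Hypothesis f_inj : injective f.

(** Let [m] be the limit of the polynomials tending to [min(s ^ 2, r ^ 2)],
    evaluated at [h]; its norm is at most [r ^ 2].  On [f h], of norm less than
    [r], they tend to [(f h) ^ 2], so that [f m = f (h ^ 2)] and, by
    injectivity, [m = h ^ 2]. *)
Lemma injective_starhom_sa_le (h : A) (r : R) : star h = h -> cnorm h < 1 ->
  cnorm (f h) < r -> r < 1 -> cnorm h <= r.
Proof.
move=> hs h1 fhr r1; have r0 : 0 <= r by apply: le_trans (ltW fhr);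
  exact: cnorm_ge0.
pose rho := r ^+ 2.
have rho01 : 0 <= rho <= 1 by rewrite exprn_ge0 // expr_le1 // ltW.
pose Q := min_poly rho; pose u n := horner_alg h (Q n).
have uC m n : cnorm (u m - u n) <= m.+1%:R^-1 + n.+1%:R^-1.
  rewrite /u -rmorphB; apply: (@horner_alg_le _ _ _ h 1) => // s s1.
  rewrite hornerD hornerN !horner_min_poly -rmorphB normc_def /= expr0n addr0.
  rewrite sqrtr_sqr lecR -(subrKA (Num.min (s ^+ 2) rho)).
  rewrite (le_trans (ler_normD _ _)) // lerD ?min_iter_close //.
  by rewrite distrC min_iter_close.
have [l ul] : exists l : A, u @ \oo --> l.
  apply: cstar_cauchy_cvg => e e0.
  have [N HN] := @inv_succ_small (e / 2) (divr_gt0 e0 (ltr0n _ 2)).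
  exists N => m n Nm Nn; rewrite (le_lt_trans (uC m n)) // (splitr e).
  by rewrite ltrD ?HN.
have lr : cnorm l <= rho.
  apply/ler_addgt0Pr => e e0.
  have [N HN] := @inv_succ_small (e / 2) (divr_gt0 e0 (ltr0n _ 2)).
  have /cnorm_cvgP/(_ (e / 2) (divr_gt0 e0 (ltr0n _ 2)))[N' HN'] := ul.
  pose n := maxn N N'; have := HN n (leq_maxl _ _);
    have := HN' n (leq_maxr _ _).
  have : cnorm (u n) <= rho + n.+1%:R^-1.
    apply: (@horner_alg_le _ _ _ h 1) => // s s1.
    rewrite horner_min_poly normc_def /= expr0n addr0 sqrtr_sqr lecR.
    have := min_iter_close n rho01 s1.
    have : 0 <= Num.min (s ^+ 2) rho <= rho.
      by rewrite le_min sqr_ge0 ge_min lexx orbT; case/andP: rho01 => ->.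
    move: (Num.min _ _) (min_iter _ _ _) (_^-1) => z y w /andP[z0 zr].
    rewrite !ler_norml => /andP[H1 H2].
    by apply/andP; split; lra.
  have := cnormD (u n) (l - u n); rewrite (cnormB l) addrC subrK.
  by move: (_^-1) => w; rewrite (splitr e); lra.
have fl : f l = f (h * h).
  apply: (cstar_cvg_uniq (starhom_cvg ul)); apply/cnorm_cvgP => e e0.
  have [N HN] := @inv_succ_small e e0.
  exists N => n /HN; apply: le_lt_trans.
  have -> : f (u n) - f (h * h) = horner_alg (f h) (Q n - 'X^2).
    rewrite starhom_horner_alg [RHS]rmorphB rmorphXn /= horner_algX.
    by rewrite [f (h * h)]rmorphM -expr2.
  apply: (@horner_alg_le _ _ _ (f h) r); rewrite -?star_morph ?hs // => s sr.
  rewrite hornerD hornerN hornerXn horner_min_poly -rmorphXn -rmorphB.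
  rewrite normc_def /= expr0n addr0 sqrtr_sqr lecR.
  have := min_iter_close n rho01 (le_trans sr (ltW r1)).
  rewrite min_l // /rho -(@real_normK _ s) ?num_real //.
  by rewrite lerXn2r ?nnegrE.
have lh : l = h * h by exact: f_inj.
by rewrite -(@ler_pXn2r R 2) ?nnegrE ?cnorm_ge0 // -cnorm_starM hs -lh.
Qed.

Lemma injective_starhom_isometric (x : A) : cnorm (f x) = cnorm x.
Proof.
apply/eqP; rewrite eq_le starhom_contractive /=.
have sa (h : A) : star h = h -> cnorm h <= cnorm (f h).
  move=> hs; set c := cnorm h + 1.
  have c0 : 0 < c by rewrite ltr_wpDl ?cnorm_ge0.
  have cn (E : cstarAlgType R) (y : E) : cnorm (c^-1%:C *: y) = cnorm y / c.
    by rewrite cnormZR gtr0_norm ?invr_gt0 // mulrC.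
  suff : cnorm (c^-1%:C *: h) <= cnorm (f (c^-1%:C *: h)).
    by rewrite starhom_realZ !cn ler_pM2r ?invr_gt0.
  have h1 : cnorm (c^-1%:C *: h) < 1.
    by rewrite cn ltr_pdivrMr // mul1r ltrDl.
  have f1 := le_lt_trans (starhom_contractive f _) h1.
  rewrite leNgt; apply/negP => /midf_lt[H1 H2].
  set r := (_ + _) / 2 in H1 H2.
  have := @injective_starhom_sa_le (c^-1%:C *: h) r _ h1 H1 (lt_trans H2 h1).
  by rewrite star_realZ hs leNgt H2 => /(_ erefl).
rewrite -(@ler_pXn2r R 2) ?nnegrE ?cnorm_ge0 // -!cnorm_starM
  -star_morph -rmorphM.
by apply: sa; rewrite starM starK.
Qed.

End InjectiveIsometric.

(** * Dense *-subalgebras and function algebras *)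

Section Approximation.
Variables (R : realType) (A : cstarAlgType R).
Implicit Types (x y : A) (P X : set A).

Lemma near_cnorm x (e : R) : 0 < e -> \forall y \near x, cnorm (x - y) < e.
Proof.
move=> e0; have FF : Filter (nbhs x) := nbhs_filter x.
by have /cvg_cnormP/(_ e e0) := @cvg_id _ (nbhs x).
Qed.

Lemma closed_cnormP P :
  closed P <-> forall x, (forall e : R, 0 < e -> exists2 y,
    P y & cnorm (x - y) < e) -> P x.
Proof.
split=> [cP x H|H x clx].
  apply: cP => B /nbhs_ballP[d /= d0 dB].
  have dE : d = (complex.Re d)%:C by rewrite RRe_real // gtr0_real.
  have rd : 0 < complex.Re d by rewrite -ltcR -dE.
  have [y Py xy] := H _ rd; exists y; split=> //; apply: dB.
  by rewrite -ball_normE /ball_ /= cnormE dE ltcR.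
apply: H => e e0; have [y [Py xy]] := clx _ (near_cnorm x e0).
by exists y.
Qed.

(** A [is_cstar_subalgebra] that need not be closed. *)
Record is_star_subalgebra P : Prop := {
  star_subalg_1 : P 1 ;
  star_subalg_D : forall x y, P x -> P y -> P (x + y) ;
  star_subalg_Z : forall (c : R[i]) x, P x -> P (c *: x) ;
  star_subalg_M : forall x y, P x -> P y -> P (x * y) ;
  star_subalg_star : forall x, P x -> P (star x)
}.

Lemma star_subalg_X P x n : is_star_subalgebra P -> P x -> P (x ^+ n).
Proof.
move=> [P1 PD PZ PM PS] Px; elim: n => [|n IH]; first by rewrite expr0.
by rewrite exprS; exact: PM.
Qed.

Lemma star_subalg_sum P (I : Type) (r : seq I) (F : I -> A) :
  is_star_subalgebra P -> (forall i, P (F i)) -> P (\sum_(i <- r) F i).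
Proof.
move=> [P1 PD PZ PM PS] PF; elim/big_ind : _ => //.
by rewrite -(scale0r 1); exact: PZ.
Qed.

(** The closure of a *-subalgebra is a C*-subalgebra. *)
Lemma star_subalg_dense P X : is_star_subalgebra P -> generates X -> X `<=` P ->
  forall x (e : R), 0 < e -> exists2 y, P y & cnorm (x - y) < e.
Proof.
move=> [P1 PD PZ PM PS] gX XP.
pose Q := [set x | forall e : R, 0 < e -> exists2 y, P y & cnorm (x - y) < e].
have PQ x : P x -> Q x by move=> Px e e0; exists x; rewrite // subrr cnorm0.
suff QT : Q = [set: A] by move=> x; suff : Q x by []; rewrite QT.
apply: gX; last by move=> x /XP/PQ.
split=> [|x y Qx Qy e e0|c x Qx e e0|x y Qx Qy e e0|x Qx e e0|].
- exact: PQ.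
- have [x' Px xx] := Qx _ (divr_gt0 e0 (ltr0n _ 2)).
  have [y' Py yy] := Qy _ (divr_gt0 e0 (ltr0n _ 2)).
  exists (x' + y'); first exact: PD.
  rewrite opprD addrACA (le_lt_trans (cnormD _ _)) // (splitr e); exact: ltrD.
- set r := complex.Re `|c|; have r0 : 0 <= r
  by rewrite -lecR RRe_real ?normr_real ?normr_ge0.
  have r1 : 0 < r + 1 by rewrite ltr_wpDl.
  have [x' Px xx] := Qx _ (divr_gt0 e0 r1).
  exists (c *: x'); first exact: PZ.
  rewrite -scalerBr cnormZr -/r.
  move: xx; rewrite ltr_pdivlMr //; apply: le_lt_trans.
  by rewrite mulrC ler_wpM2l ?cnorm_ge0 // lerDl.
- have [x' Px xx] : exists2 x', P x' & cnorm (x - x') * (cnorm y + 1) < e / 2.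
    have y1 : 0 < cnorm y + 1 by rewrite ltr_wpDl ?cnorm_ge0.
    have [x' Px xx] := Qx _ (divr_gt0 (divr_gt0 e0 (ltr0n _ 2)) y1).
    by exists x'; rewrite // -ltr_pdivlMr.
  have [y' Py yy] : exists2 y', P y' & cnorm (y - y') * (cnorm x' + 1) < e / 2.
    have y1 : 0 < cnorm x' + 1 by rewrite ltr_wpDl ?cnorm_ge0.
    have [y' Py yy] := Qy _ (divr_gt0 (divr_gt0 e0 (ltr0n _ 2)) y1).
    by exists y'; rewrite // -ltr_pdivlMr.
  exists (x' * y'); first exact: PM.
  have -> : x * y - x' * y' = (x - x') * y + x' * (y - y').
    by rewrite mulrBl mulrBr addrA subrK.
  have := cnormD ((x - x') * y) (x' * (y - y')).
  have := cnormM (x - x') y; have := cnormM x' (y - y').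
  have := cnorm_ge0 (x - x'); have := cnorm_ge0 (y - y').
  rewrite mulrC in yy; lra.
- have [x' Px xx] := Qx _ e0; exists (star x'); first exact: PS.
  by rewrite -starB cnorm_star.
- apply/closed_cnormP => x H e e0.
  have [y Qy xy] := H _ (divr_gt0 e0 (ltr0n _ 2)).
  have [z Pz yz] := Qy _ (divr_gt0 e0 (ltr0n _ 2)); exists z => //.
  by rewrite (le_lt_trans (cnorm_tri _ y _)) // (splitr e) ltrD.
Qed.

End Approximation.

Section FunctionAlgebra.
Variables (R : realType) (A : cstarAlgType R).
Implicit Types (f g : CI A) (t : segment R).

Definition CI_ev t f : A := f t.

Lemma CI_ev_linear t : linear (CI_ev t). Proof. by []. Qed.
Lemma CI_ev_monoid t : GRing.monoid_morphism (CI_ev t). Proof. by []. Qed.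
Lemma CI_ev_star t f : CI_ev t (star f) = star (CI_ev t f). Proof. by []. Qed.

HB.instance Definition _ t :=
  GRing.isLinear.Build R[i] (CI A) A *:%R (CI_ev t) (CI_ev_linear t).
HB.instance Definition _ t :=
  GRing.isMonoidMorphism.Build (CI A) A (CI_ev t) (CI_ev_monoid t).
HB.instance Definition _ t :=
  isStarMorphism.Build R (CI A) A (CI_ev t) (CI_ev_star t).

Definition CI_cst (a : A) : CI A := CI_mk (@cst_continuous (segment R) A a).

Lemma segment_setT_compact : compact [set: segment R].
Proof.
(* The segment, with its own topology, is the image of an interval of [R] by
   this truncation. *)
have cl r : Num.max (-1) (Num.min 1 r) \in segment R.
  rewrite inE /segment /= in_itv /= le_max ge_max ge_min lexx /= !lexx /=.
  by rewrite andbT; lra.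
pose c r : segment R := exist _ (Num.max (-1) (Num.min 1 r)) (cl r).
have -> : [set: segment R] = [set c r | r in `[-1, 1]].
  apply/esym/seteqP; split=> // t _; have := set_valP t.
  rewrite /segment /= in_itv /= => /andP[t1 t2].
  exists (set_val t); first by rewrite /= in_itv /= t1.
  by apply: val_inj; rewrite /= min_r // max_r.
apply: continuous_compact (@segment_compact R (-1) 1).
apply: continuous_subspaceT.
apply: (@continuous_comp_initial _ _ _ (@set_val R (segment R))).
have -> : set_val \o c = (cst (-1) \max (cst 1 \min id)) :> (R -> R) by [].
move=> x; apply: (@continuous_max R R); first exact: cst_continuous.
by apply: (@continuous_min R R); [exact: cst_continuous|exact: cvg_id].
Qed.

Lemma CI_dist_cts f : continuous (fun p : segment R * segment R =>
  cnorm (f p.1 - f p.2)).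
Proof.
move=> p; have FF : Filter (nbhs p) := nbhs_filter p.
apply/cvgrPdist_lt => e e0.
have e20 : 0 < e / 2 by rewrite divr_gt0.
have c1 : f q.1 @[q --> p] --> f p.1.
  by apply: (@cvg_comp _ _ _ fst f _ (nbhs p.1));
    [exact: cvg_fst|exact: CI_cts].
have c2 : f q.2 @[q --> p] --> f p.2.
  by apply: (@cvg_comp _ _ _ snd f _ (nbhs p.2));
    [exact: cvg_snd|exact: CI_cts].
move/cvg_cnormP : c1 => /(_ _ e20) c1; move/cvg_cnormP : c2 => /(_ _ e20) c2.
apply: filterS2 c1 c2 => q q1 q2; apply: le_lt_trans (cnorm_dist _ _) _.
have -> : f p.1 - f p.2 - (f q.1 - f q.2) = f p.1 - f q.1 - (f p.2 - f q.2).
  by rewrite !opprB addrACA [RHS]addrACA [- f p.2 - _]addrC.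
rewrite (le_lt_trans (cnormD _ _)) // cnormN (splitr e); exact: ltrD.
Qed.

(** The segment is compact, so a function that factors through [f] does so
    uniformly. *)
Lemma CI_modulus f g : (forall t t', f t = f t' -> g t = g t') ->
  forall e : R, 0 < e -> exists2 d : R, 0 < d &
    forall t t', cnorm (f t - f t') < d -> cnorm (g t - g t') < e.
Proof.
move=> fg e e0.
pose K := [set p : segment R * segment R | e <= cnorm (g p.1 - g p.2)].
have cK : compact K.
  apply: (@subclosed_compact _ _ ([set: segment R] `*` [set: segment R])) => //.
    apply: (preimage_closed _ (@closed_ge R e)) => p _; exact: CI_dist_cts.
  exact: compact_setX segment_setT_compact segment_setT_compact.
have : closed [set cnorm (f p.1 - f p.2) | p in K].
  apply: compact_closed; first exact: Rhausdorff.
  by apply: continuous_compact cK; apply: continuous_subspaceT;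
    exact: CI_dist_cts.
rewrite -openC openE => /(_ 0) H.
have /H/nbhs_ballP[d /= d0 dB] : (~` [set cnorm (f p.1 - f p.2) | p in K]) 0.
  move=> [[t t'] /= tK /cnorm0_eq0/eqP]; rewrite subr_eq0 => /eqP/fg gtt.
  by move: tK; rewrite /K /= gtt subrr cnorm0 leNgt e0.
exists d => // t t' ftt; rewrite ltNge; apply/negP => tK.
apply: (dB (cnorm (f t - f t'))); last by exists (t, t').
by rewrite -ball_normE /ball_ /= sub0r normrN ger0_norm ?cnorm_ge0.
Qed.

End FunctionAlgebra.
Arguments CI_ev : simpl never.

(** * The Fejer kernel and the half circle *)

Section Fejer.
Variable R : realType.

Definition modulus (x : R[i]) : R := complex.Re `|x|.

Lemma modulusE (x : R[i]) : (modulus x)%:C = `|x|.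
Proof. by rewrite /modulus RRe_real ?normr_real. Qed.

Lemma modulus_ge0 (x : R[i]) : 0 <= modulus x.
Proof. by rewrite -lecR modulusE normr_ge0. Qed.

Lemma modulusM (x y : R[i]) : modulus (x * y) = modulus x * modulus y.
Proof. by apply: complexI; rewrite rmorphM !modulusE normrM. Qed.

(** The Fejer kernel [|1 + x + ... + x^(n-1)|^2], sampled at the rotations of
    [s] by the [n]-th roots of unity. *)
Definition fejer_weight n (z s : R[i]) (k : nat) : R :=
  modulus (\sum_(i < n) (s * (z ^+ k)^*) ^+ i) ^+ 2 / n%:R ^+ 2.

Lemma fejer_weight_ge0 n z s k : 0 <= fejer_weight n z s k.
Proof. by rewrite divr_ge0 ?exprn_ge0 ?modulus_ge0. Qed.

Lemma fejer_weight_sum n (z s : R[i]) : n.-primitive_root z -> `|s| = 1 ->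
  \sum_(k < n) fejer_weight n z s k = 1.
Proof.
move=> zP s1; have n0 := prim_order_gt0 zP.
have nn0 : n%:R ^+ 2 != 0 :> R by rewrite expf_neq0 // pnatr_eq0 -lt0n.
rewrite -mulr_suml; apply: (mulIf nn0); rewrite mul1r divfK //.
apply: complexI; rewrite rmorph_sum rmorphXn rmorph_nat /=.
have sc : s * s^* = 1 by rewrite -normCK s1 expr1n.
have term k : ((modulus (\sum_(i < n) (s * (z ^+ k)^*) ^+ i)) ^+ 2)%:C =
    \sum_(i < n) \sum_(j < n)
      s ^+ j * (s^*) ^+ i * ((z ^+ k) ^+ i * ((z ^+ k)^*) ^+ j).
  rewrite rmorphXn /= modulusE normCK rmorph_sum /= mulrC mulr_suml.
  apply: eq_bigr => i _; rewrite mulr_sumr; apply: eq_bigr => j _.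
  rewrite rmorphXn rmorphM /= conjCK !exprMn; ring.
under eq_bigr => k _ do rewrite term.
rewrite exchange_big /=.
under eq_bigr => i _ do rewrite exchange_big /=.
have inner (i j : 'I_n) : \sum_(k < n) s ^+ j * (s^*) ^+ i *
    ((z ^+ k) ^+ i * ((z ^+ k)^*) ^+ j) = if j == i then n%:R else 0.
  rewrite -mulr_sumr prim_root_ortho //.
  have [ij|ij] := eqVneq (i : nat) j;
    last by rewrite mulr0 -val_eqE /= eq_sym ifN.
  by rewrite -val_eqE /= ij eqxx -exprMn sc expr1n mul1r.
under eq_bigr => i _ do (under eq_bigr => j _ do rewrite inner).
under eq_bigr => i _ do rewrite -big_mkcond /= big_pred1_eq.
by rewrite sumr_const card_ord -[LHS]mulr_natl expr2.
Qed.

(** [(1 - x) (1 + ... + x^(n-1)) = 1 - x^n] bounds the weight away from the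
    point where it concentrates. *)
Lemma fejer_weight_concentrates n (z s : R[i]) :
  n.-primitive_root z -> `|s| = 1 ->
  \sum_(k < n) fejer_weight n z s k * modulus (s - z ^+ k) ^+ 2 <= 4 / n%:R.
Proof.
move=> zP s1; have n0 := prim_order_gt0 zP.
have n0R : 0 < n%:R :> R by rewrite ltr0n.
have z1 : `|z| = 1 by apply: (@prim_root_norm _
  n) => //; exact: prim_expr_order.
apply: (@le_trans _ _ (\sum_(k < n) 4 / n%:R ^+ 2)); last first.
  by rewrite sumr_const card_ord -[leLHS]mulr_natl expr2 invfM mulrCA mulVKf
    ?gt_eqF.
apply: ler_sum => k _; rewrite /fejer_weight mulrAC ler_pM2r ?invr_gt0
  ?exprn_gt0 //.
set x := s * (z ^+ k)^*; have x1 : `|x| = 1.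
  by rewrite normrM norm_conjC normrX s1 z1 expr1n mulr1.
have -> : modulus (s - z ^+ k) = modulus (x - 1).
  apply: complexI; rewrite !modulusE.
  have -> : x - 1 = (s - z ^+ k) * (z ^+ k)^*.
    by rewrite mulrBl -normCK normrX z1 !expr1n.
  by rewrite normrM norm_conjC normrX z1 expr1n mulr1.
rewrite -exprMn -modulusM mulrC -subrX1.
have m2 : modulus (x ^+ n - 1) <= 2.
  rewrite -lecR modulusE (le_trans (ler_normB _ _)) // normrX x1 expr1n normr1.
  by rewrite rmorph_nat.
have := modulus_ge0 (x ^+ n - 1); nra.
Qed.

(** [exp (i pi r / 2)], on the right half of the unit circle for [r] in
    [[-1, 1]]. *)
Definition half_circle (r : R) : R[i] := cos (pi / 2 * r) +i* sin (pi / 2 * r).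

Lemma half_circle_norm r : `|half_circle r| = 1.
Proof. by rewrite normc_def /= cos2Dsin2 sqrtr1. Qed.

Lemma half_circle_right : half_circle 1 = 'i.
Proof. by rewrite /half_circle mulr1 cos_pihalf sin_pihalf. Qed.

Lemma half_circle_left : half_circle (-1) = - 'i.
Proof.
rewrite /half_circle mulrN1 cosN sinN cos_pihalf sin_pihalf.
by apply/eqP; rewrite eq_complex /= oppr0 !eqxx.
Qed.

Lemma half_circle_onto (s : R[i]) : `|s| = 1 -> 0 <= complex.Re s ->
  exists t : segment R, half_circle (set_val t) = s.
Proof.
case: s => a b /=; rewrite normc_def /= => - /complexI s1 a0.
have ab : a ^+ 2 + b ^+ 2 = 1.
  by rewrite -[LHS]sqr_sqrtr ?s1 ?expr1n // addr_ge0 ?sqr_ge0.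
have b1 : -1 <= b <= 1.
  by rewrite -ler_norml -(@ler_pXn2r _ 2) ?nnegrE // real_normK
    ?num_real // expr1n -ab lerDr sqr_ge0.
have p0 : 0 < pi / 2 :> R by rewrite divr_gt0 ?pi_gt0.
have tP : asin b / (pi / 2) \in segment R.
  rewrite inE /segment /= in_itv /= ler_pdivlMr // ler_pdivrMr // mulN1r mul1r.
  by rewrite asin_geNpi2 // asin_lepi2.
exists (exist (fun x : R => x \in segment R) _ tP); rewrite /half_circle /=.
rewrite mulrC divfK ?gt_eqF // asinK ?in_itv // cos_asin //.
by rewrite -ab addrK sqrtr_sqr ger0_norm.
Qed.

(** One of the two square roots of [s] has nonnegative real part. *)
Lemma half_circle_sqr_onto (s : R[i]) : `|s| = 1 ->
  exists t : segment R, half_circle (set_val t) ^+ 2 = s.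
Proof.
move=> s1; pose r := sqrtC s; have r2 : r ^+ 2 = s by exact: sqrtCK.
have r1 : `|r| = 1.
  by apply/eqP; rewrite -(@pexpr_eq1 _ _ 2) ?normr_ge0 // -normrX r2 s1.
have [r0|r0] := leP 0 (complex.Re r).
  by have [t tr] := half_circle_onto r1 r0; exists t; rewrite tr.
have [||t tr] := @half_circle_onto (- r); first by rewrite normrN.
  by rewrite raddfN /= oppr_ge0 ltW.
by exists t; rewrite tr sqrrN.
Qed.

(** The only identification made by [t |-> exp (i pi t)] is that of the two end
    points. *)
Lemma half_circle_sqr_eq (t t' : segment R) :
  half_circle (set_val t) ^+ 2 = half_circle (set_val t') ^+ 2 ->
  [\/ t = t', t = segm1 /\ t' = seg1 | t = seg1 /\ t' = segm1].
Proof.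
have p0 : 0 < pi / 2 :> R by rewrite divr_gt0 ?pi_gt0.
have itv (u : segment R) : - (pi / 2) <= pi / 2 * set_val u <= pi / 2.
  have := set_valP u; rewrite /segment /= in_itv /= => /andP[u1 u2].
  have := ler_wpM2l (ltW p0) u1; have := ler_wpM2l (ltW p0) u2.
  by rewrite mulrN1 mulr1 => -> ->.
have sin_eq (u u' : R) : -(pi / 2) <= pi / 2 * u <= pi / 2 ->
    -(pi / 2) <= pi / 2 * u' <= pi / 2 ->
    sin (pi / 2 * u) = sin (pi / 2 * u') -> u = u'.
  move=> uI uI' /(congr1 asin); rewrite !sinK ?in_itv //.
  by apply: mulfI; rewrite gt_eqF.
move=> /eqP; rewrite eqf_sqr => /orP[/eqP[_ /sin_eq H]|/eqP[cE sE]].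
  by apply: Or31; apply: val_inj; apply: H; apply: itv.
have c0 (u : segment R) : 0 <= cos (pi / 2 * set_val u).
  by apply: cos_ge0_pihalf; exact: itv.
have ct : cos (pi / 2 * set_val t) = 0.
  by apply/eqP; rewrite eq_le c0 andbT cE oppr_le0 c0.
have i1 : - (pi / 2) <= pi / 2 * (1 : R) <= pi / 2 by exact: (itv seg1).
have iN1 : - (pi / 2) <= pi / 2 * (-1 : R) <= pi / 2 by exact: (itv segm1).
have st' : sin (pi / 2 * set_val t') = - sin (pi / 2 * set_val t)
  by rewrite sE opprK.
have := cos2Dsin2 (pi / 2 * set_val t).
rewrite ct expr0n add0r => /eqP; rewrite sqrf_eq1 => /orP[/eqP st|/eqP st].
  apply: Or33; split; apply: val_inj; apply: sin_eq => //; try exact: itv.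
    by rewrite st mulr1 sin_pihalf.
  by rewrite st' st mulrN1 sinN sin_pihalf.
apply: Or32; split; apply: val_inj; apply: sin_eq => //; try exact: itv.
  by rewrite st mulrN1 sinN sin_pihalf.
by rewrite st' st opprK mulr1 sin_pihalf.
Qed.

End Fejer.

(** * Approximation of periodic functions *)

Section FejerApproximation.
Variables (R : realType) (A : cstarAlgType R).

Lemma realZ_cts (f : segment R -> R) (x : A) : continuous f ->
  continuous (fun t => (f t)%:C *: x).
Proof.
move=> cf t; have FF : Filter (nbhs t) := nbhs_filter t.
apply/cvg_cnormP => e e0.
have c0 : 0 < cnorm x + 1 by rewrite ltr_wpDl ?cnorm_ge0.
have /cvgrPdist_lt/(_ _ (divr_gt0 e0 c0)) := cf t.
apply: filterS => t' tt'; rewrite -scalerBl -rmorphB cnormZR.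
move: tt'; rewrite ltr_pdivlMr //; apply: le_lt_trans.
by rewrite ler_wpM2l // lerDl.
Qed.

Lemma half_circle_cts (x : A) :
  continuous (fun t : segment R => half_circle (set_val t) *: x).
Proof.
have -> : (fun t : segment R => half_circle (set_val t) *: x) =
    (fun t => (cos (pi / 2 * set_val t))%:C *: x +
              (sin (pi / 2 * set_val t))%:C *: ('i *: x)).
  apply/funext => t; rewrite scalerA -scalerDl; congr (_ *: _).
  by rewrite [LHS]complexE /= [X in _ = _ + X]mulrC.
have angle : continuous (fun t : segment R => pi / 2 * set_val t).
  move=> t; apply: (@continuous_comp (segment R) R R (@set_val R (segment R))
    ( *%R (pi / 2))).
    exact: (@initial_continuous _ _ (@set_val R (segment R))).
  exact: mulrl_continuous.
have ccos : continuous (fun t : segment R => cos (pi / 2 * set_val t)).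
  by move=> t; exact: continuous_comp (angle t) (@continuous_cos R _).
have csin : continuous (fun t : segment R => sin (pi / 2 * set_val t)).
  by move=> t; exact: continuous_comp (angle t) (@continuous_sin R _).
by move=> t; exact: (cvgD (@realZ_cts _ x ccos t)
  (@realZ_cts _ ('i *: x) csin t)).
Qed.

Definition half_circle_CI (x : A) : CI A := CI_mk (@half_circle_cts x).

(** The Fejer weights at [s = exp (i pi t)] average the samples of [g] at the
    points that map to the [n]-th roots of unity.  They have total mass 1 and
    concentrate near [s], where [g], a function of [s], varies little.  Up to a
    constant a weight is [star (Y k) * Y k], where [Y k] is a polynomial in
    [exp (i pi t)], so that the sum stays in [P]. *)
Lemma fejer_approx (P : set (CI A)) (g : CI A) :
  is_star_subalgebra P -> P (half_circle_CI 1 ^+ 2) ->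
  (forall t, P (CI_cst (g t))) -> g segm1 = g seg1 ->
  forall e : R, 0 < e -> exists2 f, P f & cnorm (g - f) < e.
Proof.
move=> PA PZ Pg gper e e0; set Z := half_circle_CI 1 ^+ 2 in PZ.
have ZE t : CI_ev t Z = half_circle (set_val t) ^+ 2 *: 1.
  by rewrite rmorphXn /= /CI_ev /= exprZn expr1n.
have Zg t t' : Z t = Z t' -> g t = g t'.
  have := ZE t; have := ZE t'; rewrite /CI_ev => -> -> /eqP.
  rewrite -subr_eq0 -scalerBl scaler_eq0 oner_eq0 orbF subr_eq0 => /eqP.
  by move=> /half_circle_sqr_eq[->//|[-> ->]|[-> ->]]; rewrite gper.
have [d d0 gd] := CI_modulus Zg (divr_gt0 e0 (ltr0n _ 2)).
(* With [s], [s'] the images of [t], [t'] on the unit circle,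
   [cnorm (g t - g t') <= e / 2 + K |s - s'| ^ 2]. *)
pose K := 2 * cnorm g / d ^+ 2.
have K0 : 0 <= K by rewrite divr_ge0 ?exprn_ge0 ?mulr_ge0 ?cnorm_ge0 // ltW.
have K1 : 0 < 4 * K + 1 by apply: ltr_wpDl => //; exact: mulr_ge0.
have [N HN] : exists N, forall n, (N <= n)%N
  -> n.+1%:R^-1 < e / 2 / (4 * K + 1).
  by apply: inv_succ_small; rewrite !divr_gt0.
pose n := N.+1; have [z zP] := @prim_root_exists R n isT.
have z1 : `|z| = 1 by apply: (@prim_root_norm _
  n) => //; exact: prim_expr_order.
have zk k : `|z ^+ k| = 1 by rewrite normrX z1 expr1n.
have [tk tkE] := choice (fun k => half_circle_sqr_onto (zk k)).
pose Y k : CI A := \sum_(i < n) ((z ^+ k)^*) ^+ i *: Z ^+ i.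
pose W k := ((n%:R ^- 2 : R)%:C) *: (star (Y k) * Y k).
have [P1 PD PZs PM PS] := PA.
have PY k : P (Y k).
  by apply: star_subalg_sum => // i; apply: PZs; exact: star_subalg_X.
exists (\sum_(k < n) W k * CI_cst (g (tk k))).
  by apply: star_subalg_sum => // k; apply: (PM) => //; apply: PZs;
    apply: PM => //; exact: PS.
pose s (t : segment R) := half_circle (set_val t) ^+ 2.
have s1 t : `|s t| = 1 by rewrite normrX half_circle_norm expr1n.
have YE k t : CI_ev t (Y k) = (\sum_(i < n) (s t * (z ^+ k)^*) ^+ i) *: 1.
  rewrite raddf_sum scaler_suml; apply: eq_bigr => i _ /=.
  by rewrite linearZ /= [CI_ev t (_ ^+ _)]rmorphXn /= ZE -/(s t) exprZn expr1n
    scalerA [X in _ = X *: _]exprMn mulrC.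
have WE k t : CI_ev t (W k) = (fejer_weight n z (s t) k)%:C *: 1.
  rewrite linearZ rmorphM /= -[CI_ev t (star _)]/(star (CI_ev t (Y k))) YE.
  rewrite starZ star1 -scalerAl mul1r !scalerA; congr (_ *: _).
  rewrite -mulrA /fejer_weight [in RHS]mulrC [RHS]rmorphM; congr (_ * _).
  by rewrite [RHS]rmorphXn /= modulusE normCK mulrC.
apply: (@le_lt_trans _ _ (e / 2 + 4 * K * n%:R^-1)); last first.
  have := HN N (leqnn N); rewrite ltr_pdivlMr //.
  have : 0 < n%:R^-1 :> R by rewrite invr_gt0 ltr0n.
  rewrite -/n; move: (n%:R^-1) => v v0; lra.
apply: CI_norm_le => t; rewrite -[_ t]/(CI_ev t _) raddfB raddf_sum /=.
have -> : CI_ev t g = \sum_(k < n) (fejer_weight n z (s t) k)%:C *: g t.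
  by rewrite -scaler_suml -rmorph_sum fejer_weight_sum ?scale1r.
rewrite -sumrB (le_trans (cnorm_sum _ _ _)) //.
have term (k : 'I_n) : true -> cnorm ((fejer_weight n z (s t) k)%:C *: g t -
    CI_ev t (W k * CI_cst (g (tk k)))) <=
  fejer_weight n z (s t) k * (e / 2) +
  K * (fejer_weight n z (s t) k * modulus (s t - z ^+ k) ^+ 2).
  move=> _; rewrite [CI_ev t (_ * _)]rmorphM /= WE -scalerAl mul1r
    -scalerBr cnormZR.
  rewrite ger0_norm ?fejer_weight_ge0 // [X in _ <= _ + X]mulrCA -mulrDr.
  rewrite ler_wpM2l ?fejer_weight_ge0 // -[CI_ev t _]/(g (tk k)).
  have distE : cnorm (Z t - Z (tk k)) = modulus (s t - z ^+ k).
    have := ZE t; have := ZE (tk k); rewrite /CI_ev tkE => -> ->.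
    by rewrite -scalerBl cnormZr cnorm1 mulr1.
  have [near|far] := ltP (modulus (s t - z ^+ k)) d.
    rewrite (le_trans (ltW (gd _ _ _))) ?distE // lerDl.
    by rewrite mulr_ge0 ?exprn_ge0 ?modulus_ge0.
  apply: (@le_trans _ _ (2 * cnorm g)).
    have := cnormD (g t) (- g (tk k)); rewrite cnormN.
    have := CI_norm_ge g t; have := CI_norm_ge g (tk k).
    rewrite -[CI_norm g]/(cnorm g); lra.
  apply: (@le_trans _ _ (K * modulus (s t - z ^+ k) ^+ 2)); last first.
    by rewrite lerDr divr_ge0 // ltW.
  rewrite /K mulrAC ler_pdivlMr ?exprn_gt0 //.
  rewrite ler_wpM2l ?mulr_ge0 ?cnorm_ge0 //.
  by rewrite lerXn2r ?nnegrE ?modulus_ge0 // ltW.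
rewrite (le_trans (ler_sum _ term)) // big_split
  /= -mulr_suml fejer_weight_sum //.
rewrite mul1r lerD2l -mulr_sumr [4 * K]mulrC -[leRHS]mulrA ler_wpM2l //.
exact: fejer_weight_concentrates.
Qed.

End FejerApproximation.

(** * Constructions of *-homomorphisms *)

Section StarHoms.
Variable R : realType.
Implicit Types A B D : cstarAlgType R.

Lemma starhom_id_star A (x : A) : idfun (star x) = star (idfun x).
Proof. by []. Qed.
HB.instance Definition _ A :=
  isStarMorphism.Build R A A (@idfun A) (@starhom_id_star A).

Lemma starhom_comp_star A B D (g : {starhom B -> D}) (f : {starhom A -> B}) x :
  (g \o f) (star x) = star ((g \o f) x).
Proof. by rewrite /= !star_morph. Qed.
HB.instance Definition _ A B D (g : {starhom B -> D}) (f : {starhom A -> B}) :=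
  isStarMorphism.Build R A D (g \o f) (starhom_comp_star g f).

Definition conj_by A (u : A) (uU : Defs.is_unitary u) (x : A) := u * x * star u.

Lemma conj_by_linear A (u : A) (uU : Defs.is_unitary u) : linear (conj_by uU).
Proof.
by move=> c x y; rewrite /conj_by mulrDr mulrDl -scalerAr -scalerAl.
Qed.
Lemma conj_by_monoid A (u : A) (uU : Defs.is_unitary u) :
  GRing.monoid_morphism (conj_by uU).
Proof.
case: (uU) => u1 u2; split=> [|x y]; rewrite /conj_by ?mulr1 //.
by rewrite !mulrA -(mulrA (u * x) (star u) u) u1 mulr1.
Qed.
Lemma conj_by_star A (u : A) (uU : Defs.is_unitary u) x :
  conj_by uU (star x) = star (conj_by uU x).
Proof. by rewrite /conj_by !starM starK mulrA. Qed.
HB.instance Definition _ A (u : A) (uU : Defs.is_unitary u) :=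
  GRing.isLinear.Build R[i] A A *:%R (conj_by uU) (conj_by_linear uU).
HB.instance Definition _ A (u : A) (uU : Defs.is_unitary u) :=
  GRing.isMonoidMorphism.Build A A (conj_by uU) (conj_by_monoid uU).
HB.instance Definition _ A (u : A) (uU : Defs.is_unitary u) :=
  isStarMorphism.Build R A A (conj_by uU) (conj_by_star uU).

Lemma CI_cst_linear A : linear (@CI_cst R A).
Proof. by move=> c x y; apply: CI_ext. Qed.
Lemma CI_cst_monoid A : GRing.monoid_morphism (@CI_cst R A).
Proof. by split=> [|x y]; apply: CI_ext. Qed.
Lemma CI_cst_star A (x : A) : CI_cst (star x) = star (CI_cst x).
Proof. by apply: CI_ext. Qed.
HB.instance Definition _ A :=
  GRing.isLinear.Build R[i] A (CI A) *:%R (@CI_cst R A) (@CI_cst_linear A).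
HB.instance Definition _ A :=
  GRing.isMonoidMorphism.Build A (CI A) (@CI_cst R A) (@CI_cst_monoid A).
HB.instance Definition _ A :=
  isStarMorphism.Build R A (CI A) (@CI_cst R A) (@CI_cst_star A).

(** By continuity, the equalizer is a C*-subalgebra. *)
Lemma starhom_eq_generators A D (f g : {starhom A -> D}) (X : set A) :
  generates X -> (forall x, X x -> f x = g x) -> forall x, f x = g x.
Proof.
move=> gX fg; pose E := [set x | f x = g x].
suff ET : E = [set: A] by move=> x; suff : E x by []; rewrite ET.
apply: gX => //; rewrite /E; split=> [|y z|c y|y z|y|].
- by rewrite /= !rmorph1.
- by rewrite /= !raddfD /= => -> ->.
- by rewrite /= !linearZ /= => ->.
- by rewrite /= !rmorphM /= => -> ->.
- by rewrite /= !star_morph /= => ->.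
apply/closed_cnormP => y H /=; apply/eqP; rewrite -subr_eq0.
apply/eqP/cnorm0_eq0/eqP; rewrite eq_le cnorm_ge0 andbT.
apply/ler_addgt0Pr => e e0; rewrite add0r.
have [z /= fgz yz] := H _ (divr_gt0 e0 (ltr0n _ 2)).
have -> : f y - g y = f (y - z) - g (y - z)
  by rewrite [f (y - z)]raddfB [g (y - z)]raddfB /= fgz opprB addrA subrK.
have := cnormD (f (y - z)) (- g (y - z)); rewrite cnormN.
have := starhom_contractive f (y - z); have := starhom_contractive g (y - z).
by rewrite (splitr e); lra.
Qed.

(** An isometry reflects Cauchy sequences. *)
Lemma isometric_range_closed A D (f : {starhom A -> D}) (y : D) :
  (forall x, cnorm (f x) = cnorm x) ->
  (forall e : R, 0 < e -> exists2 x, range f x & cnorm (y - x) < e) ->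
  exists x, f x = y.
Proof.
move=> fI H.
have step n : exists x, cnorm (y - f x) < n.+1%:R^-1.
  have [|_ [x _ <-] yx] := H n.+1%:R^-1; first by rewrite invr_gt0.
  by exists x.
have [u uP] := choice step.
have uy : f (u n) @[n --> \oo] --> y.
  apply/cnorm_cvgP => e /inv_succ_small[N HN]; exists N => n Nn.
  by rewrite cnormB; exact: lt_trans (uP n) (HN _ Nn).
have [l ul] : exists l : A, u @ \oo --> l.
  apply: cstar_cauchy_cvg => e e0.
  have /cnorm_cvgP/(_ _ (divr_gt0 e0 (ltr0n _ 2)))[N HN] := uy.
  exists N => m n Nm Nn; rewrite -fI raddfB.
  rewrite (le_lt_trans (cnorm_tri _ y _)) // (splitr e) ltrD ?HN //.
  by rewrite cnormB HN.
by exists l; apply: cstar_cvg_uniq uy; exact: starhom_cvg.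
Qed.

Lemma range_star_subalgebra A D (f : {starhom A -> D}) :
  is_star_subalgebra (range f).
Proof.
split=> [|_ _ [x _ <-] [y _ <-]|c _ [x _ <-]|_ _ [x _ <-] [y _ <-]|_ [x _ <-]].
- by exists 1; rewrite ?rmorph1.
- by exists (x + y); rewrite ?raddfD.
- by exists (c *: x); rewrite ?linearZ.
- by exists (x * y); rewrite ?rmorphM.
- by exists (star x); rewrite ?star_morph.
Qed.

Definition CI_map A D (f : {starhom A -> D}) (g : CI A) : CI D :=
  CI_mk (fun t => continuous_comp (@CI_cts _ _ g t)
    (@starhom_continuous _ _ _ f (g t))).

End StarHoms.

Section UnitaryPowers.
Variables (R : realType) (B : cstarAlgType R) (V : B).
Hypothesis V_unitary : Defs.is_unitary V.

(** [V ^+ p * star V ^+ q] stands for the integer power [V^(p - q)]. *)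
Lemma unitary_power_diff a b c d : (a + d = c + b)%N ->
  V ^+ a * star V ^+ b = V ^+ c * star V ^+ d.
Proof.
have shift k p q : V ^+ (p + k) * star V ^+ (q + k) = V ^+ p * star V ^+ q.
  have [_] := unitary_exp k V_unitary; rewrite starX => VV.
  by rewrite exprD [(q + k)%N]addnC exprD mulrA -(mulrA (V ^+ p)) VV mulr1.
move=> adcb; have [ac|ca] := leqP a c.
  by rewrite -(shift (c - a)%N) subnKC //; congr (_ * _ ^+ _); lia.
by rewrite -[RHS](shift (a - c)%N) subnKC 1?ltnW //; congr (_ * _ ^+ _); lia.
Qed.

End UnitaryPowers.

(** * Laurent sums in a crossed product *)

Section Laurent.
Variables (R : realType) (A B : cstarAlgType R) (j : {starhom A -> B}) (V : B).
Variable sigma : {starhom A -> A}.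
Hypothesis V_unitary : Defs.is_unitary V.
Hypothesis Vj : forall a, V * j a = j (sigma a) * V.
Hypothesis V'j : forall a, star V * j a = j (sigma a) * star V.

(** Laurent sums of degree at most [d] are written with nonnegative powers of
    [V] and a common denominator [V ^+ d]. *)
Definition laurent d : set B := [set x | exists a : nat -> A,
  x = \sum_(n < (d + d).+1) j (a n) * V ^+ n * star V ^+ d].

Lemma laurent_add d x y : laurent d x -> laurent d y -> laurent d (x + y).
Proof.
move=> [a ->] [b ->]; exists (fun n => a n + b n); rewrite -big_split.
by apply: eq_bigr => n _; rewrite raddfD !mulrDl.
Qed.

Lemma laurent_scale d (c : R[i]) x : laurent d x -> laurent d (c *: x).
Proof.
move=> [a ->]; exists (fun n => c *: a n); rewrite scaler_sumr.
by apply: eq_bigr => n _; rewrite linearZ /= !scalerAl.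
Qed.

Lemma laurent_sum d (I : Type) (r : seq I) (F : I -> B) :
  (forall i, laurent d (F i)) -> laurent d (\sum_(i <- r) F i).
Proof.
move=> H; elim/big_ind : _ => //; last exact: laurent_add.
by exists (fun=> 0); rewrite big1 // => n _; rewrite raddf0 !mul0r.
Qed.

Lemma laurent_monomial d a p q : (p <= q + d)%N -> (q <= p + d)%N ->
  laurent d (j a * V ^+ p * star V ^+ q).
Proof.
move=> pq qp; have nd : (p + d - q < (d + d).+1)%N by lia.
exists (fun n => if n == (p + d - q)%N then a else 0).
rewrite (bigD1 (Ordinal nd)) //= eqxx big1 => [|n nn]; last first.
  by rewrite ifN ?raddf0 ?mul0r.
rewrite addr0 -!mulrA; congr (_ * _); apply: unitary_power_diff => //; lia.
Qed.

Lemma laurent_widen d d' x : (d <= d')%N -> laurent d x -> laurent d' x.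
Proof.
move=> dd' [a ->]; apply: laurent_sum => n; have := ltn_ord n.
by move=> nd; apply: laurent_monomial; lia.
Qed.

Lemma laurent_shift p q a :
  V ^+ p * star V ^+ q * j a = j (iter (p + q) sigma a) * V ^+ p * star V ^+ q.
Proof.
have Vp n b : V ^+ n * j b = j (iter n sigma b) * V ^+ n.
  elim: n => [|n IH]; first by rewrite !expr0 mul1r mulr1.
  by rewrite exprS -mulrA IH mulrA Vj -mulrA -exprS.
have V'q n b : star V ^+ n * j b = j (iter n sigma b) * star V ^+ n.
  elim: n => [|n IH]; first by rewrite !expr0 mul1r mulr1.
  by rewrite exprS -mulrA IH mulrA V'j -mulrA -exprS.
by rewrite -mulrA V'q mulrA Vp iterD.
Qed.

Lemma laurent_mul d d' x y :
  laurent d x -> laurent d' y -> laurent (d + d') (x * y).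
Proof.
move=> [a ->] [b ->]; rewrite mulr_suml; apply: laurent_sum => n.
rewrite mulr_sumr; apply: laurent_sum => m.
have -> : j (a n) * V ^+ n * star V ^+ d * (j (b m) * V ^+ m * star V ^+ d') =
    j (a n * iter (n + d) sigma (b m)) * V ^+ (n + m) * star V ^+ (d + d').
  have cVV : V ^+ m * star V ^+ d = star V ^+ d * V ^+ m.
    have [V1 V2] := V_unitary.
    apply: commrX; apply/commr_sym/commrX; rewrite /GRing.comm V1 V2 //.
  rewrite rmorphM !exprD -!mulrA; congr (_ * _).
  by rewrite [V ^+ m * (_ * _)]mulrA cVV !mulrA laurent_shift.
by have := ltn_ord n; have := ltn_ord m; move=> mb nb; apply: laurent_monomial;
  lia.
Qed.

Lemma laurent_star d x : laurent d x -> laurent d (star x).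
Proof.
move=> [a ->]; rewrite star_sum; apply: laurent_sum => n.
rewrite !starM !starX starK -star_morph mulrA laurent_shift.
by have := ltn_ord n => nd; apply: laurent_monomial; lia.
Qed.

Lemma laurent_exp d x m : laurent d x -> laurent (m * d) (x ^+ m).
Proof.
move=> xd; elim: m => [|m IH]; last by rewrite exprS mulSn; exact: laurent_mul.
rewrite mul0n expr0; have := @laurent_monomial 0 1 0 0 isT isT.
by rewrite rmorph1 !expr0 !mulr1.
Qed.

Lemma laurent_star_subalgebra : is_star_subalgebra
  [set x | exists d, laurent d x].
Proof.
split=> [|x y [d xd] [d' yd]|c x [d xd]|x y [d xd] [d' yd]|x [d xd]].
- exists 0%N; have := @laurent_monomial 0 1 0 0 isT isT.
  by rewrite rmorph1 !expr0 !mulr1.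
- exists (d + d')%N; apply: laurent_add.
    by apply: laurent_widen xd; lia.
  by apply: laurent_widen yd; lia.
- by exists d; exact: laurent_scale.
- by exists (d + d')%N; exact: laurent_mul.
- by exists d; exact: laurent_star.
Qed.

Lemma laurent_generators : range j `|` [set V] `<=`
  [set x | exists d, laurent d x].
Proof.
move=> x [[a _ <-]|->].
  by exists 0%N; have := @laurent_monomial 0 a 0 0 isT isT;
    rewrite !expr0 !mulr1.
by exists 1%N; have := @laurent_monomial 1 1 1 0 isT isT;
  rewrite rmorph1 expr0 expr1 mulr1 mul1r.
Qed.

End Laurent.

(** * The crossed products by the flip *)

Lemma unitary_scale (R : realType) (A : cstarAlgType R) (c : R[i]) (u : A) :
  `|c| = 1 -> Defs.is_unitary u -> Defs.is_unitary (c *: u).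
Proof.
move=> c1 [u1 u2]; have cc : c * c^* = 1 by rewrite -normCK c1 expr1n.
by split; rewrite starZ -scalerAl -scalerAr scalerA 1?mulrC ?cc
  ?scale1r // mulrC cc scale1r.
Qed.

Section FlipCrossedProducts.
Variables (R : realType) (A : cstarAlgType R) (S1 S2 : A).
Hypothesis hA : is_cuntz_algebra S1 S2.
Variable sigma : {starhom A -> A}.
Hypotheses (sigma1 : sigma S1 = S2) (sigma2 : sigma S2 = S1).

Lemma flip_involutive a : sigma (sigma a) = a.
Proof.
have [_ gA] := hA.
apply: (starhom_eq_generators (f := sigma \o sigma) (g := idfun) gA).
by move=> x [->|->] /=; rewrite ?sigma1 ?sigma2.
Qed.

Variables (C : cstarAlgType R) (e : {starhom A -> C}) (w : C).
Hypothesis hC : is_flip_crossed_product_Z2 S1 S2 e w.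
Variable sigmahat : {starhom C -> C}.
Hypothesis sigmahat_id : forall a : A, sigmahat (e a) = e a.
Hypothesis sigmahat_w : sigmahat w = - w.

Let ww : w * w = 1. Proof. by rewrite -expr2; case: hC. Qed.

Lemma flip_unitary_star : star w = w.
Proof.
have [_ [w1 _] _ _ _ _] := hC.
by rewrite -[LHS]mulr1 -ww mulrA w1 mul1r.
Qed.

Lemma flip_covariant a : w * e a = e (sigma a) * w.
Proof.
have [_ [w1 w2] _ we _ _] := hC; have wU : Defs.is_unitary w by [].
have [_ gA] := hA.
have H : forall a, (conj_by wU \o e) a = (e \o sigma) a.
  apply: (starhom_eq_generators gA) =>
    x [->|->] /=; rewrite /conj_by ?sigma1 ?sigma2.
    by rewrite we -mulrA w2 mulr1.
  have <- : w * (w * e S1) = e S1 by rewrite mulrA ww mul1r.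
  by rewrite flip_unitary_star we mulrA.
have := H a; rewrite /= /conj_by => <-.
by rewrite -mulrA w1 mulr1.
Qed.

Lemma dual_involutive c : sigmahat (sigmahat c) = c.
Proof.
have [_ _ _ _ gC _] := hC.
apply: (starhom_eq_generators (f := sigmahat \o sigmahat) (g := idfun) gC).
by move=> x [[->|->]|->] /=; rewrite ?sigmahat_id // sigmahat_w raddfN
  /= sigmahat_w opprK.
Qed.

(** As [sigmahat (e a + e b * w) = e a - e b * w], the parts of [c] fixed and
    negated by [sigmahat] give the two coefficients of [c]. *)
Definition even_coef c := (2^-1 : R)%:C *: (c + sigmahat c).
Definition odd_coef c := (2^-1 : R)%:C *: (c - sigmahat c) * w.

Lemma even_odd_decomposition c : c = even_coef c + odd_coef c * w.
Proof.
by rewrite /odd_coef -mulrA ww mulr1 -scalerDr addrACA subrr addr0 half2.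
Qed.

Lemma even_odd_coefs a b :
  even_coef (e a + e b * w) = e a /\ odd_coef (e a + e b * w) = e b.
Proof.
have hatE : sigmahat (e a + e b * w) = e a - e b * w.
  by rewrite raddfD /= rmorphM /= !sigmahat_id sigmahat_w mulrN.
rewrite /even_coef /odd_coef hatE.
split; first by rewrite addrACA subrr addr0 half2.
by rewrite opprD opprK addrACA subrr add0r half2 -mulrA ww mulr1.
Qed.

Lemma even_coefB c c' : even_coef (c - c') = even_coef c - even_coef c'.
Proof.
by rewrite /even_coef [sigmahat (c - c')]raddfB -scalerBr opprD addrACA.
Qed.

Lemma odd_coefB c c' : odd_coef (c - c') = odd_coef c - odd_coef c'.
Proof.
rewrite /odd_coef [sigmahat (c - c')]raddfB /= -mulrBl -scalerBr.
congr (_ *: _ * w).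
by rewrite !opprB addrACA [RHS]addrACA [- c' - _]addrC.
Qed.

Lemma even_coef_le c : cnorm (even_coef c) <= cnorm c.
Proof.
rewrite cnormZR ger0_norm ?invr_ge0 //.
have := cnormD c (sigmahat c); have := starhom_contractive sigmahat c; lra.
Qed.

Lemma odd_coef_le c : cnorm (odd_coef c) <= cnorm c.
Proof.
have [_ [_ w2] _ _ _ _] := hC.
rewrite cnorm_Mcoiso // cnormZR ger0_norm ?invr_ge0 //.
have := cnormD c (- sigmahat c); rewrite cnormN.
have := starhom_contractive sigmahat c; lra.
Qed.

Lemma even_odd_star_subalgebra :
  is_star_subalgebra [set c | exists a b, c = e a + e b * w].
Proof.
split=> [|x y [a [b ->]] [c [d ->]]|z x [a [b ->]]|x y
  [a [b ->]] [c [d ->]]|x [a [b ->]]].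
- by exists 1, 0; rewrite rmorph1 raddf0 mul0r addr0.
- by exists (a + c), (b + d); rewrite !raddfD mulrDl addrACA.
- by exists (z *: a), (z *: b); rewrite !linearZ /= scalerDr scalerAl.
- exists (a * c + b * sigma d), (a * d + b * sigma c).
  have bc : e b * w * e c = e (b * sigma c) * w.
    by rewrite -mulrA flip_covariant mulrA rmorphM.
  have bd : e b * w * (e d * w) = e (b * sigma d).
    by rewrite -mulrA (mulrA w) flip_covariant -(mulrA (e _)) ww mulr1 rmorphM.
  rewrite mulrDl !mulrDr bc bd [e (_ + _)]raddfD [e (a * d + _)]raddfD /=.
  rewrite [e (a * c)]rmorphM [e (a * d)]rmorphM /= mulrDl mulrA.
  by rewrite [e _ * w + e _]addrC addrACA.
- exists (star a), (sigma (star b)).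
  by rewrite starD starM -!star_morph flip_unitary_star flip_covariant.
Qed.

(** It holds on the dense *-subalgebra of the elements [e a + e b * w], and
    the range of the isometric map [e] is closed. *)
Lemma even_odd_coef_range c : range e (even_coef c) /\ range e (odd_coef c).
Proof.
have [e_inj _ _ _ gC _] := hC; have eI := injective_starhom_isometric e_inj.
have dense (d : R) : 0 < d -> exists a b, cnorm (c - (e a + e b * w)) < d.
  move=> d0; have [|_ [a [b ->]] H] :=
    star_subalg_dense even_odd_star_subalgebra gC _ c d0.
    move=> x [[->|->]|->].
    - by exists S1, 0; rewrite raddf0 mul0r addr0.
    - by exists S2, 0; rewrite raddf0 mul0r addr0.
    - by exists 0, 1; rewrite raddf0 rmorph1 mul1r add0r.
  by exists a, b.
suff [[a aE] [b bE]] :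
    (exists a, e a = even_coef c) /\ exists b, e b = odd_coef c.
  by split; [exists a|exists b].
split; apply: (isometric_range_closed eI) => d /dense[a [b abd]].
  exists (e a); first by exists a.
  have [aE _] := even_odd_coefs a b; rewrite -aE -even_coefB.
  exact: le_lt_trans (even_coef_le _) abd.
exists (e b); first by exists b.
have [_ bE] := even_odd_coefs a b; rewrite -bE -odd_coefB.
exact: le_lt_trans (odd_coef_le _) abd.
Qed.

Variables (B : cstarAlgType R) (j : {starhom A -> B}) (V : B).
Hypothesis hB : is_crossed_product_Z sigma j V.

(** The pair of the constant functions [e a] and of [z w] is covariant because
    [w] implements [sigma] and the scalar [z] has modulus 1. *)
Lemma crossed_product_to_functions : exists phi : {starhom B -> CI C},
  (forall a, phi (j a) = CI_cst (e a)) /\ phi V = half_circle_CI w.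
Proof.
have [_ [w1 w2] _ _ _ _] := hC.
have zz (t : segment R) : (half_circle (set_val t))^* * half_circle
  (set_val t) = 1 :> R[i].
  by rewrite mulrC -normCK half_circle_norm expr1n.
pose z (t : segment R) : C := half_circle (set_val t) *: w.
have zU t : Defs.is_unitary (z t).
  by apply: unitary_scale; [exact: half_circle_norm|split].
have uU : Defs.is_unitary (half_circle_CI w).
  split; apply: CI_ext => t.
    by rewrite -[LHS]/(star (z t) * z t) -[RHS]/(1 : C); case: (zU t).
  by rewrite -[LHS]/(z t * star (z t)) -[RHS]/(1 : C); case: (zU t).
have [_ _ _ _ /(_ (CI C) (@CI_cst R C \o e) (half_circle_CI w) uU)] := hB.
apply=> a; apply: CI_ext => t.
rewrite -[LHS]/(z t * e a * star (z t)) -[RHS]/(e (sigma a)).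
rewrite starZ -!scalerAl -scalerAr scalerA mulrC zz scale1r.
by rewrite flip_covariant -mulrA w2 mulr1.
Qed.

Variable phi : {starhom B -> CI C}.
Hypothesis phi_j : forall a, phi (j a) = CI_cst (e a).
Hypothesis phi_V : phi V = half_circle_CI w.

Let V_unitary : Defs.is_unitary V. Proof. by case: hB. Qed.

Let Vj a : V * j a = j (sigma a) * V.
Proof.
have [_ [V1 _] VjV _ _] := hB.
by rewrite -VjV -mulrA V1 mulr1.
Qed.

Let V'j a : star V * j a = j (sigma a) * star V.
Proof.
have [V1 V2] := V_unitary.
rewrite -[in LHS](flip_involutive a) -[LHS]mulr1 -V2 mulrA -[_ * V]mulrA -Vj.
by rewrite !mulrA V1 mul1r.
Qed.

(** The values of [phi x] are, up to a unitary factor, the sums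
    [sum_m s ^ m (e (a m) w ^ m)] for [s] in the right half of the unit circle.
    Applying [sigmahat] changes the sign of [s] and gives the left half. *)
Lemma laurent_coef_le d (a : nat -> A) (x : B) n : (n < (d + d).+1)%N ->
  x = \sum_(n < (d + d).+1) j (a n) * V ^+ n * star V ^+ d ->
  cnorm (a n) <= cnorm (phi x).
Proof.
move=> nd xE; have [e_inj [w1 w2] _ _ _ _] := hC.
have wX k := unitary_exp k (conj w1 w2).
have -> : cnorm (a n) = cnorm (e (a n) * w ^+ n).
  rewrite cnorm_Mcoiso; last by case: (wX n).
  by rewrite injective_starhom_isometric.
apply: (@fourier_coef_le _ C (d + d).+1 (fun m => e (a m) * w ^+ m)) nd => s s1.
pose F (s : R[i]) := \sum_(m < (d + d).+1) s ^+ m *: (e (a m) * w ^+ m).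
have half (t : segment R) : cnorm (F (half_circle (set_val t))) <= cnorm
  (phi x).
  apply: (@le_trans _ _ (cnorm (phi x t))); last exact: CI_norm_ge.
  set z := half_circle (set_val t).
  have -> : phi x t = F z * star (z *: w) ^+ d.
    rewrite -[LHS]/((CI_ev t \o phi) x) xE raddf_sum mulr_suml.
    apply: eq_bigr => m _ /=.
    have phiX : phi (j (a m) * V ^+ m * star V ^+ d) =
        CI_cst (e (a m)) * half_circle_CI w ^+ m * star (half_circle_CI w) ^+ d.
      by rewrite !rmorphM /= !rmorphXn /= star_morph /= phi_j phi_V.
    rewrite phiX !rmorphM /= !rmorphXn /= star_morph /=.
    rewrite -[CI_ev t (CI_cst _)]/(e (a m)) -[CI_ev t _]/(z *: w).
    by rewrite [in LHS]exprZn -scalerAr.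
  have zwU : Defs.is_unitary (z *: w).
    by apply: unitary_scale; [exact: half_circle_norm|split].
  by rewrite cnorm_Mcoiso //; case: (unitary_exp d (unitary_star zwU)).
have [s0|s0] := leP 0 (complex.Re s).
  by have [t tE] := half_circle_onto s1 s0; rewrite -tE; exact: half.
have [||t tE] := @half_circle_onto _ (- s); first by rewrite normrN.
  by rewrite raddfN /= oppr_ge0 ltW.
have -> : \sum_(m < (d + d).+1) s ^+ m *: (e (a m) * w ^+ m) =
    sigmahat (F (half_circle (set_val t))).
  rewrite tE raddf_sum; apply: eq_bigr => m _ /=.
  rewrite linearZ /= rmorphM /= rmorphXn /= sigmahat_id sigmahat_w.
  by rewrite -[- w]scaleN1r exprZn -scalerAr scalerA -exprMn mulrN1 opprK.
exact: le_trans (starhom_contractive _ _) (half t).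
Qed.

Lemma laurent_crude_le d x : laurent j V d x ->
  cnorm x <= (d + d).+1%:R * cnorm (phi x).
Proof.
move=> [a xE]; rewrite {1}xE (le_trans (cnorm_sum _ _ _)) //.
have VX k := unitary_exp k V_unitary.
apply: le_trans (_ : \sum_(n < (d + d).+1) cnorm (phi x) <= _); last first.
  by rewrite sumr_const card_ord mulr_natl.
apply: ler_sum => n _.
rewrite -starX cnorm_Mcoiso; last by case: (unitary_star (VX d)).
rewrite cnorm_Mcoiso; last by case: (VX n).
exact: le_trans (starhom_contractive _ _) (laurent_coef_le (ltn_ord n) xE).
Qed.

Lemma phi_isometric x : cnorm (phi x) = cnorm x.
Proof.
have [_ _ _ gB _] := hB.
apply/eqP; rewrite eq_le starhom_contractive /=.
have L d y : laurent j V d y -> cnorm y <= cnorm (phi y).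
  move=> yd; set D := (d + d)%N.
  have yy : laurent j V D (star y * y).
    by apply: (laurent_mul V_unitary Vj V'j) => //; exact: (laurent_star
      V_unitary Vj V'j).
  apply: (@cnorm_le_of_powers _ _ _ _ (D + D)%:R 1); first exact: cnorm_ge0.
  move=> m; have := laurent_crude_le (laurent_exp V_unitary Vj V'j m yy).
  move=> /le_trans; apply.
  rewrite rmorphXn rmorphM /= star_morph -natr1.
  have -> : (m * D + m * D)%:R = (D + D)%:R * m%:R :> R.
    by rewrite -natrM -mulnDr mulnC.
  rewrite ler_wpM2l ?addr_ge0 ?mulr_ge0 //.
  by rewrite -cnorm_starM cnormX.
apply/ler_addgt0Pr => d d0.
have [y [n yn] xy] := star_subalg_dense
  (laurent_star_subalgebra V_unitary Vj V'j) gB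
  (@laurent_generators _ _ _ _ _ V_unitary) x (divr_gt0 d0 (ltr0n _ 2)).
have := L _ _ yn; have := cnormD y (x - y); rewrite addrC subrK.
have := cnormD (phi x) (phi y - phi x); rewrite addrC subrK.
have := starhom_contractive phi (y - x); rewrite raddfB cnormB in xy *.
rewrite (splitr d); lra.
Qed.

Lemma phi_twisted x : phi x segm1 = sigmahat (phi x seg1).
Proof.
have [_ _ _ gB _] := hB.
apply: (starhom_eq_generators (f := CI_ev segm1 \o phi)
  (g := sigmahat \o (CI_ev seg1 \o phi)) gB) => y [[a _ <-]|->] /=.
  by rewrite phi_j -[LHS]/(e a) -[CI_ev _ _]/(e a) sigmahat_id.
rewrite phi_V -[LHS]/(half_circle (-1) *: w) -[CI_ev _ _]/(half_circle 1 *: w).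
by rewrite linearZ /= half_circle_left half_circle_right sigmahat_w scalerN
  scaleNr.
Qed.

(** The square of [phi V = z w] is the function [z ^ 2 = exp (i pi t)]. *)
Lemma periodic_in_range (g : CI C) :
  (forall t, range e (g t)) -> g segm1 = g seg1 -> exists x, phi x = g.
Proof.
move=> ge gper; apply: (isometric_range_closed phi_isometric).
apply: fejer_approx gper; first exact: range_star_subalgebra.
  exists (V ^+ 2) => //; rewrite rmorphXn /= phi_V; apply: CI_ext => t.
  rewrite -[LHS]/((half_circle (set_val t) *: w) * (half_circle
    (set_val t) *: w)).
  rewrite -[RHS]/((half_circle (set_val t) *: 1) * (half_circle
    (set_val t) *: 1)).
  by rewrite -!scalerAl -!scalerAr ww mulr1.
by move=> t; have [a _ <-] := ge t; exists (j a).
Qed.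

(** Write [f = ev + od * (z w)] with [ev] and [od] valued in [e A].  Going from
    one end point to the other, the gluing condition negates the coefficient of
    [w] in [f], and [conj z] changes sign too, so that both [ev] and [od] are
    periodic. *)
Lemma twisted_in_range (f : CI C) : f segm1 = sigmahat (f seg1) ->
  exists x, phi x = f.
Proof.
move=> fper.
have fper' : sigmahat (f segm1) = f seg1 by rewrite fper dual_involutive.
pose ev : CI C := (2^-1 : R)%:C *: (f + CI_map sigmahat f).
pose od : CI C :=
  star (half_circle_CI 1) * ((2^-1 : R)%:C *: (f - CI_map sigmahat f) * CI_cst
    w).
have evE t : ev t = even_coef (f t) by [].
have odE t : od t = (half_circle (set_val t))^* *: odd_coef (f t).
  rewrite -[LHS]/(star (half_circle (set_val t) *: 1) * odd_coef (f t)).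
  by rewrite starZ star1 -scalerAl mul1r.
have [x1 x1E] : exists x, phi x = ev.
  apply: periodic_in_range; last first.
    by rewrite !evE /even_coef fper' fper addrC.
  by move=> t; rewrite evE; case: (even_odd_coef_range (f t)).
have [x2 x2E] : exists x, phi x = od.
  apply: periodic_in_range; last first.
    rewrite !odE -[set_val _]/(-1 : R) -[set_val seg1]/(1 : R).
    rewrite half_circle_left half_circle_right rmorphN /= scaleNr -scalerN.
    by rewrite /odd_coef fper' fper -mulNr -scalerN opprB.
  move=> t; rewrite odE; have [_ [b _ bE]] := even_odd_coef_range (f t).
  by exists ((half_circle (set_val t))^* *: b); rewrite // linearZ /= bE.
exists (x1 + x2 * V); rewrite raddfD /= rmorphM /= x1E x2E phi_V;
  apply: CI_ext => t.
rewrite -[LHS]/(ev t + od t * (half_circle (set_val t) *: w)) evE odE.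
rewrite -scalerAl -scalerAr scalerA mulrC -normCK half_circle_norm expr1n
  scale1r.
by rewrite -even_odd_decomposition.
Qed.

End FlipCrossedProducts.

Theorem theorem4p2 (R : realType)
    (A : cstarAlgType R) (S1 S2 : A) (hA : is_cuntz_algebra S1 S2)
    (sigma : {starhom A -> A}) (sigma_aut : is_automorphism sigma)
    (sigma1 : sigma S1 = S2) (sigma2 : sigma S2 = S1)
    (B : cstarAlgType R) (j : {starhom A -> B}) (V : B)
    (hB : is_crossed_product_Z sigma j V)
    (C : cstarAlgType R) (e : {starhom A -> C}) (w : C)
    (hC : is_flip_crossed_product_Z2 S1 S2 e w)
    (sigmahat : {starhom C -> C}) (sigmahat_aut : is_automorphism sigmahat)
    (sigmahat_id : forall a : A, sigmahat (e a) = e a)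
    (sigmahat_w : sigmahat w = - w) :
  star_isomorphic_to B [set f : CI C | f segm1 = sigmahat (f seg1)].
Proof.
have [phi [phi_j phi_V]] := crossed_product_to_functions hA sigma1 sigma2 hC hB.
exists phi; split.
  move=> x y phixy; apply/eqP; rewrite -subr_eq0; apply/eqP/cnorm0_eq0.
  rewrite -(phi_isometric hA sigma1 sigma2 hC sigmahat_id sigmahat_w hB phi_j
    phi_V).
  by rewrite raddfB /= phixy subrr cnorm0.
apply/seteqP; split=> [_ [x _ <-]|f fper] /=.
  exact: (phi_twisted sigmahat_id sigmahat_w hB phi_j phi_V).
have [x xf] := twisted_in_range hA sigma1 sigma2 hC sigmahat_id sigmahat_w hB
  phi_j phi_V fper.
by exists x.
Qed.
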